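(* Let $(X,\mathcal{C}_0,\mathcal{F},\tau)$ be a measurable locally convex vector space (e.v.l.c.m.), $d\ge 1$ an integer, $D$ a convex subset of $X$, $(\mu_\Lambda)_{\Lambda\in\mathbb{B}}$ a compatible translation-invariant system of probabilities (s.c.i.t.) on $X^{\mathbb{Z}^d}$ carried by $D^{\mathbb{Z}^d}$, and $(\mu_n)_{n\ge1}$ the associated Cramér sequence, with entropy $s$ and pressure $p$. Suppose that $(\mu_\Lambda)_{\Lambda\in\mathbb{B}}$ is asymptotically decoupled from below (a.d.i.) and locally controlled (c.l.). Then: (1) for every $K\in\mathcal{F}$ such that $K\cap D$ is relatively compact, $$\limsup_{n\to\infty}\frac{1}{|\Lambda(n)|}\log\mu_n(K)\le\sup_{\overline{K}}s ;$$ in particular, $(\mu_n)_{n\ge1}$ and $(\mu_n|_D)_{n\ge1}$ satisfy a weak large deviations principle; (2) for every $\lambda\in X^*$, $$p(\lambda)=\lim_{n\to\infty}\frac{1}{|\Lambda(n)|}\log\int e^{|\Lambda(n)|\langle\lambda|x\rangle}\,d\mu_n(x)$$ (the limit exists in $[-\infty,+\infty]$), and for every $\lambda\in X^*$ and $x\in X$, $p(\lambda)-s(x)\ge\langle\lambda|x\rangle$; (3) if moreover $(\mu_\Lambda)_{\Lambda\in\mathbb{B}}$ is locally convex-tight (c.t.l.) on $D$, then $$\forall x\in X\qquad s(x)=\inf_{\lambda\in X^*}\big(p(\lambda)-\langle\lambda|x\rangle\big).$$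
   Context: **Internal convex sets.** For a convex subset $C$ of a real vector space $X$, its gauge is $M_C(x)=\inf\{t\ge0: x\in tC\}\in[0,+\infty]$. $C$ is internal if $M_C$ is finite everywhere and $C=\{x: M_C(x)<1\}$. If $\mathcal{F}$ is a $\sigma$-algebra on $X$, $\mathcal{C}_0(\mathcal{F})$ is the set of $\mathcal{F}$-measurable internal convex subsets of $X$. **E.v.l.c.m.** $(X,\mathcal{C}_0,\mathcal{F},\tau)$ is an e.v.l.c.m. if $X$ is a real vector space, $\mathcal{F}$ is a $\sigma$-algebra on $X$ stable under dilations (of nonzero ratio) and translations, $\mathcal{C}_0\subset\mathcal{C}_0(\mathcal{F})$ is a family of symmetric sets, stable under finite intersections and under dilations of nonzero ratio, with intersection of all its elements equal to $\{0\}$, $\tau$ is the (Hausdorff) locally convex topology having $\mathcal{C}_0$ as a fundamental system of neighbourhoods of $0$, and every continuous linear form on $X$ is $\mathcal{F}$-measurable. $X^*$ is the topological dual. For $x\in X$, $\mathcal{C}_x=\{x+C: C\in\mathcal{C}_0\}$. **Boxes and $\sigma$-algebras.** $\Lambda(n)=[0,n[^d\cap\mathbb{Z}^d$; a box is a translate of some $\Lambda(n)$, $n\ge1$; $\mathbb{B}$ is the set of boxes. For $\Lambda\in\mathbb{B}$ and $\sigma\in X^{\mathbb{Z}^d}$, $\mathfrak{m}_\Lambda(\sigma)=\frac1{|\Lambda|}\sum_{z\in\Lambda}\sigma(z)$. For finite $S\subset\mathbb{Z}^d$, $\mathcal{F}_S$ is the smallest $\sigma$-algebra on $X^{\mathbb{Z}^d}$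 making $\mathfrak{m}_\Lambda:X^{\mathbb{Z}^d}\to(X,\mathcal{F})$ measurable for all boxes $\Lambda\subset S$. For $A\subset X^{\mathbb{Z}^d}$, $A+z=\{\sigma(\cdot-z):\sigma\in A\}$. **S.c.i.t.** A family $(\mu_\Lambda)_{\Lambda\in\mathbb{B}}$, $\mu_\Lambda$ a probability on $\mathcal{F}_\Lambda$, such that $\mu_{\Lambda_2}(A)=\mu_{\Lambda_1}(A)$ for boxes $\Lambda_1\subset\Lambda_2$ and $A\in\mathcal{F}_{\Lambda_1}$, and $\mu_{\Lambda+z}(A+z)=\mu_\Lambda(A)$ for $\Lambda\in\mathbb{B}$, $z\in\mathbb{Z}^d$, $A\in\mathcal{F}_\Lambda$. One writes $\mathbb{P}(A)=\mu_\Lambda(A)$ for $A\in\mathcal{F}_\Lambda$ (independent of $\Lambda$), and likewise $\mathbb{P}(A|\mathcal{G})=\mu_\Lambda(A|\mathcal{G})$ for a sub-$\sigma$-algebra $\mathcal{G}\subset\mathcal{F}_\Lambda$; inequalities between conditional probabilities hold a.s. For $E\subset X^{\mathbb{Z}^d}$, the system is carried by $E$ if for all $\Lambda\in\mathbb{B}$ and $A,B\in\mathcal{F}_\Lambda$, $A\cap E=B\cap E$ implies $\mu_\Lambda(A)=\mu_\Lambda(B)$. The Cramér sequence is $\mu_n=\mu_{\Lambda(n)}\circ(\mathfrak{m}_{\Lambda(n)})^{-1}$, a probability on $(X,\mathcal{F})$. **A.d.i.** There exist $g,c:\mathbb{N}^*\to[0,+\infty[$ with $g(m)/m\to0$ and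 $c(m)/|\Lambda(m)|\to0$ such that for all $m\ge1$, all finite $S\subset\mathbb{Z}^d$, all $A\in\mathcal{F}_{\Lambda(m)}$, $B\in\mathcal{F}_S$: $\mathrm{dist}(S,\Lambda(m))>g(m)$ implies $\mathbb{P}(A\cap B)\ge e^{-c(m)}\mathbb{P}(A)\mathbb{P}(B)$. Here dist is the $|\cdot|_\infty$ distance on $\mathbb{Z}^d$. **C.l.** There exist $t,\alpha:\mathcal{C}_0(\mathcal{F})\to]0,+\infty[$ such that for all $C\in\mathcal{C}_0(\mathcal{F})$ and $\Lambda\in\mathbb{B}$, $\mathbb{P}(\sigma(0)\in t(C)\cdot C\,|\,\mathcal{F}_{\Lambda\setminus\{0\}})\ge\alpha(C)$. **C.t.l. on $D$.** For every $\gamma>0$ there is $K(\gamma)\in\mathcal{F}$ such that $K(\gamma)\cap D$ is convex and relatively compact and, for every box $\Lambda\ni0$, $\mathbb{P}(\sigma(0)\in K(\gamma)\,|\,\mathcal{F}_{\Lambda\setminus\{0\}})\ge1-\gamma$. **Entropy, pressure, weak LDP.** $s(x)=\inf_{C\in\mathcal{C}_x}\liminf_{n\to\infty}\frac1{|\Lambda(n)|}\log\mu_n(C)$; $p(\lambda)=\limsup_{n\to\infty}\frac1{|\Lambda(n)|}\log\int e^{|\Lambda(n)|\langle\lambda|x\rangle}d\mu_n(x)$ for $\lambda\in X^*$. By construction $\liminf_n\frac1{|\Lambda(n)|}\log\mu_n(A)\ge\sup_{\mathrm{int}A}s$ for all $A\in\mathcal{F}$. $(\mu_n)$ satisfies a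 weak large deviations principle if $\limsup_n\frac1{|\Lambda(n)|}\log\mu_n(K)\le\sup_{\overline K}s$ for every relatively compact $K\in\mathcal{F}$. $\mu_n|_D$ is the trace of $\mu_n$ on $D$ (with the trace $\sigma$-algebra and induced topology): $\mu_n|_D(A\cap D)=\mu_n(A)$ for $A\in\mathcal{F}$; its entropy and weak LDP are defined by the same formulas inside $D$ (neighbourhoods $C\cap D$ with $C\in\mathcal{C}_x$, $x\in D$; closures and relative compactness in $D$). Conventions: $\log0=-\infty$, $\sup\emptyset=-\infty$; relatively compact means having compact closure. *)

(* Defs.v *)
From HB Require Import structures.
From mathcomp Require Import all_boot all_order all_algebra finmap.
From mathcomp Require Import all_classical all_reals all_analysis.

Set Implicit Arguments.
Unset Strict Implicit.
Unset Printing Implicit Defensive.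

Import Order.TTheory GRing.Theory Num.Theory.
Import numFieldNormedType.Exports.

Local Open Scope classical_set_scope.
Local Open Scope ring_scope.
Local Open Scope ereal_scope.

(** ** Measurable locally convex vector spaces *)

(* X with the sigma-algebra F; if F is not a sigma-algebra, with the one
   generated by F. *)
Definition measType {R : realType} {X : tvsType R} (F : set (set X)) : Type := X.

Section MeasType.
Context {R : realType} {X : tvsType R} (F : set (set X)).

HB.instance Definition _ := Choice.copy (measType F) X.
HB.instance Definition _ := isPointed.Build (measType F) (0 : X)%R.

Let sigma_gen : set (set (measType F)) := <<s F >>.

Let sigma_genC (A : set (measType F)) : sigma_gen A -> sigma_gen (~` A).
Proof. by move=> FA; rewrite -setTD; exact: sigma_algebraCD. Qed.

HB.instance Definition _ := @isMeasurable.Build (sigma_display F) (measType F)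
  sigma_gen (@sigma_algebra0 _ setT F) sigma_genC (@sigma_algebra_bigcup _ setT F).

End MeasType.

Section LocallyConvex.
Context {R : realType} {X : tvsType R}.
Implicit Types (F : set (set X)) (C A : set X) (x : X).

Definition dilate (r : R) C : set X := [set (r *: x)%R | x in C].

Definition translate x C : set X := [set (x + y)%R | y in C].

(* M_C(x), with value +oo when x belongs to no tC *)
Definition gauge C x : \bar R :=
  ereal_inf [set t%:E | t in [set t : R | (0 <= t)%R /\ dilate t C x]].

Definition internal C :=
  [/\ convex_set C, forall x, gauge C x < +oo & C = [set x | gauge C x < 1]].

(* the class C_0(F) *)
Definition measurable_internal F C := F C /\ internal C.

(* The topology of X is the one having C0 as a basis of neighbourhoods of 0;
   this forces C0 to be nonempty, and it makes X Hausdorff because of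
   [evlcm_bigcap]. *)
Record evlcm F (C0 : set (set X)) : Prop := Evlcm {
  evlcm_sigma_algebra : sigma_algebra [set: X] F ;
  evlcm_dilate_sets : forall (r : R) A, r != 0%R -> F A -> F (dilate r A) ;
  evlcm_translate_sets : forall x A, F A -> F (translate x A) ;
  evlcm_internal : C0 `<=` measurable_internal F ;
  evlcm_sym : forall C, C0 C -> dilate (-1)%R C = C ;
  evlcm_setI : forall C C', C0 C -> C0 C' -> C0 (C `&` C') ;
  evlcm_dilate : forall (r : R) C, r != 0%R -> C0 C -> C0 (dilate r C) ;
  evlcm_bigcap : \bigcap_(C in C0) C = [set 0%R] ;
  evlcm_nbhs : nbhs (0%R : X) = filter_from C0 id ;
  evlcm_measurable_form : forall f : {scalar X},
    continuous f -> measurable_fun [set: measType F] (f : measType F -> R)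
}.

End LocallyConvex.

Definition rel_compact (T : topologicalType) (K : set T) := compact (closure K).

(** ** Boxes of Z^d *)

Section Boxes.
Context {d : nat}.
Local Notation Zd := 'rV[int]_d.

(* [0, n[^d *)
Definition cube (n : nat) : {fset Zd} :=
  [fset map_mx (fun k : 'I_n => (k : nat)%:Z) w | w in [set: 'rV['I_n]_d]%SET]%fset.

Definition fshift (z : Zd) (S : {fset Zd}) : {fset Zd} :=
  [fset (w + z)%R | w in S]%fset.

Record box := Box {
  box_fset :> {fset Zd} ;
  boxP : exists z n, (0 < n)%N /\ box_fset = fshift z (cube n)
}.

Lemma shift_boxP (z : Zd) (L : box) :
  exists z' n, (0 < n)%N /\ fshift z L = fshift z' (cube n).
Proof.
have [z' [n [n0 LE]]] := boxP L.
exists (z' + z)%R, n; split => //; rewrite LE.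
apply/fsetP => w; apply/imfsetP/imfsetP => /= [[u /imfsetP[v /= vn ->] ->]|].
  by exists v => //; rewrite addrA.
move=> [v vn ->]; exists (v + z')%R; last by rewrite addrA.
by apply/imfsetP; exists v.
Qed.

Definition shift_box (z : Zd) (L : box) : box := Box (shift_boxP z L).

Lemma LambdaP (n : nat) :
  exists z m, (0 < m)%N /\ cube n.-1.+1 = fshift z (cube m).
Proof.
exists 0%R, n.-1.+1; split => //; apply/fsetP => w.
apply/idP/imfsetP => /= [wn|[v vn ->]]; last by rewrite addr0.
by exists w => //; rewrite addr0.
Qed.

(* Lambda(n) for n >= 1; the value at n = 0, which is Lambda(1), is a dummy that
   is only seen by sequences of which limits are taken. *)
Definition Lambda (n : nat) : box := Box (LambdaP n).

(* |x - y|_oo *)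
Definition zdist (x y : Zd) : nat := (\max_(i < d) `|x ord0 i - y ord0 i|)%N.

(* equal to +oo if S or T is empty *)
Definition set_dist (R : realType) (S T : {fset Zd}) : \bar R :=
  ereal_inf [set ((zdist x y)%:R)%:E | x in [set` S] & y in [set` T]].

End Boxes.
Arguments box d : clear implicits.

(** ** Conditional probabilities *)

Section CondProb.
Context {R : realType} {d : measure_display} {T : measurableType d}.
Variable P : probability T R.
Implicit Types (G : set (set T)) (A : set T).

(* f is a version of P(A | G) *)
Definition cond_prob G A (f : T -> R) :=
  [/\ forall Y : set R, measurable Y -> G (f @^-1` Y),
      P.-integrable [set: T] (EFin \o f) &
      forall B, G B -> \int[P]_(x in B) (f x)%:E = P (A `&` B)].

(* P(A | G) >= a almost surely; this does not depend on the version *)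
Definition cond_prob_ge G A (a : R) :=
  exists2 f, cond_prob G A f & {ae P, forall x, (a <= f x)%R}.

End CondProb.

(** ** Compatible translation-invariant systems *)

Section Systems.
Context {R : realType} {X : tvsType R} {F : set (set X)} {d : nat}.
Local Notation Zd := 'rV[int]_d.
Local Notation config := (Zd -> X).

Definition mean (S : {fset Zd}) (s : config) : X :=
  ((#|` S|%fset%:R : R)^-1 *: \sum_(z <- S) s z)%R.

Definition mean_sets (S : {fset Zd}) : set (set (Zd -> measType F)) :=
  \bigcup_(L in [set L : box d | (L `<=` S)%fset])
    preimage_set_system [set: config] (mean L) F.

(* the sigma-algebra F_S *)
Definition sigma_loc (S : {fset Zd}) : set (set config) := <<s mean_sets S >>.

(* the measurable space of configurations with the sigma-algebra F_S *)
Definition locType (S : {fset Zd}) := g_sigma_algebraType (mean_sets S).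

Definition box_mean (L : box d) : locType L -> measType F := mean L.

Lemma measurable_box_mean (L : box d) : measurable_fun [set: locType L] (@box_mean L).
Proof.
apply: (@measurability _ _ (locType L) (measType F) setT (@box_mean L) F) => //.
move=> _ [Y FY <-]; apply: sub_gen_smallest.
by exists L; [exact: fsubset_refl|exists Y].
Qed.

HB.instance Definition _ (L : box d) :=
  isMeasurableFun.Build _ _ _ _ (@box_mean L) (@measurable_box_mean L).

Variable mu : forall L : box d, probability (locType L) R.

Definition shift_config (z : Zd) (A : set config) : set config :=
  [set (fun w => s (w - z)%R) | s in A].

Definition scit :=
  (forall L1 L2 : box d, (L1 `<=` L2)%fset ->
     forall A, sigma_loc L1 A -> mu L2 A = mu L1 A) /\
  (forall (L : box d) (z : Zd) A, sigma_loc L A ->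
     mu (shift_box z L) (shift_config z A) = mu L A).

Definition carried (E : set config) :=
  forall (L : box d) A B, sigma_loc L A -> sigma_loc L B ->
    A `&` E = B `&` E -> mu L A = mu L B.

(* In [adi], [locally_controlled] and [convex_tight], the probability P(.) of the
   system is read off mu L' for an arbitrary box L' large enough for all the
   events and sigma-algebras involved to be in F_L'. *)

Definition adi :=
  exists g c : nat -> R,
    [/\ forall m, (0 < m)%N -> (0 <= g m)%R /\ (0 <= c m)%R,
        (g m / m%:R)%R @[m --> \oo] --> (0%R : R),
        (c m / #|` @cube d m|%fset%:R)%R @[m --> \oo] --> (0%R : R) &
        forall (m : nat) (S : {fset Zd}) A B, (0 < m)%N ->
          sigma_loc (cube m) A -> sigma_loc S B ->
          (g m)%:E < set_dist R S (cube m) ->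
          forall L' : box d, (cube m `<=` L')%fset -> (S `<=` L')%fset ->
            (expR (- c m))%:E * mu L' A * mu L' B <= mu L' (A `&` B)].

Definition locally_controlled :=
  exists t alpha : set X -> R, forall C, measurable_internal F C ->
    [/\ (0 < t C)%R, (0 < alpha C)%R &
        forall L L' : box d, (L `<=` L')%fset -> 0%R \in (L' : {fset Zd}) ->
          cond_prob_ge (mu L') (sigma_loc (L `\ 0%R)%fset)
            [set s : config | dilate (t C) C (s 0%R)] (alpha C)].

Definition convex_tight (D : set X) :=
  forall gamma : R, (0 < gamma)%R -> exists K : set X,
    [/\ F K, convex_set (K `&` D), rel_compact (K `&` D) &
        forall L L' : box d, 0%R \in (L : {fset Zd}) -> (L `<=` L')%fset ->
          cond_prob_ge (mu L') (sigma_loc (L `\ 0%R)%fset)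
            [set s : config | K (s 0%R)] (1 - gamma)%R].

Definition cramer (n : nat) : probability (measType F) R :=
  distribution (mu (Lambda n)) (@box_mean (Lambda n)).

End Systems.
Arguments mean_sets {R X} F {d} S.
Arguments sigma_loc {R X} F {d} S.
Arguments locType {R X} F {d} S.

(** ** Entropy, pressure and weak large deviations *)

Section LargeDeviations.
Context {R : realType} (d : nat).

(* log a / |Lambda(n)|, where log 0 = -oo *)
Definition rate (n : nat) (a : \bar R) : \bar R :=
  ((#|` (@Lambda d n : {fset 'rV[int]_d})|%fset%:R)^-1)%:E * lne a.

Definition inf_rate {T : Type} (nu : nat -> set T -> \bar R) (V : set (set T)) :=
  ereal_inf [set limn_einf (fun n => rate n (nu n A)) | A in V].

Definition weak_ldp (T : topologicalType) (S : set (set T))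
    (nu : nat -> set T -> \bar R) (s : T -> \bar R) :=
  forall K, S K -> rel_compact K ->
    limn_esup (fun n => rate n (nu n K)) <= ereal_sup (s @` closure K).

End LargeDeviations.

Section Entropy.
Context {R : realType} {X : tvsType R} {F : set (set X)} {d : nat}.
Variables (C0 : set (set X)) (mu : forall L : box d, probability (locType F L) R).

(* the class C_x *)
Definition translates (x : X) : set (set X) := [set translate x C | C in C0].

Definition entropy (x : X) : \bar R := inf_rate d (cramer mu) (translates x).

Definition log_laplace (l : {scalar X}) (n : nat) : \bar R :=
  rate d n (\int[cramer mu n]_x
    (expR (#|` (@Lambda d n : {fset 'rV[int]_d})|%fset%:R * l (x : X)))%:E).

Definition pressure (l : {scalar X}) : \bar R := limn_esup (log_laplace l).

(* the topological dual of X *)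
Definition dual_space : set {scalar X} := [set l | continuous l].

(* Below, D is also seen as a type, with the induced topology. *)
Variable D : set X.

Definition trace_sets : set (set D) :=
  preimage_set_system [set: D] set_val F.

(* If m(A) depends only on A `&` D, for A in F, then the infimum is over a
   constant and the trace of m maps A `&` D to m(A). The measures of the Cramer
   sequence have this property when D is convex and the system is carried by
   the configurations with values in D. *)
Definition trace (m : set X -> \bar R) (B : set D) : \bar R :=
  ereal_inf [set m A | A in [set A | F A /\ set_val @^-1` A = B]].

Definition cramer_trace (n : nat) : set D -> \bar R := trace (cramer mu n).

Definition entropy_trace (x : D) : \bar R :=
  inf_rate d cramer_trace [set set_val @^-1` C | C in translates (set_val x)].

End Entropy.
Arguments dual_space {R} X.
Arguments trace_sets {R X} F D.
Arguments cramer_trace {R X F d} mu D.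
Arguments entropy_trace {R X F d} C0 mu D.

(* Main.v *)
Require Import Defs.
From HB Require Import structures.
From mathcomp Require Import all_boot all_order all_algebra finmap.
From mathcomp Require Import all_classical all_reals all_analysis.
From mathcomp Require Import measurable_realfun ring lra zify.

(** Everything rests on one construction. A large cube of side [N] is filled by
   translates of a cube of side [n], separated by gaps slightly larger than the
   distance at which decoupling from below applies, up to a small proportion of
   remaining sites ([block_sizes], [packedP]). Prescribing the mean over each
   block costs a factor [mu_n] per block and a subexponential correction
   ([blocks_ge]); at the remaining sites, local control keeps the values in a
   bounded set at a bounded cost per site ([sites_ge]). The mean over the large
   cube is then determined up to a small error, and letting [N], then [n], go to
   infinity gives approximate superadditivity in two forms.

   For balls ([decoupled_balls]): a proportion [t] of the blocks is sent near [x],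
   the others near [y]. For [x = y] this bounds the upper rate of a ball by the
   lower rate of a larger ball ([limn_esup_ball]), hence, by compactness, the
   upper rate of a relatively compact set by the supremum of the entropy; the
   same argument with an exponential weight bounds Laplace transforms over such a
   set ([laplace_upper_bound]). In general, it says that the entropy is concave
   ([entropy_concave]).

   For Laplace transforms over a set [K] whose trace on [D] is convex
   ([laplace_lower_bound]). For [K] the whole space it gives the existence of the
   limit defining the pressure. When the system is locally convex-tight, [K] may
   also be taken with relatively compact trace and almost the same Laplace
   transform for a fixed [n]; together with the upper bound on [K] this shows
   that the pressure is the conjugate of the entropy ([pressure_le_sup]).

   The last equality is then convex duality for the entropy, which is concave,
   nonpositive and upper semicontinuous ([entropy_separation]); it follows from a
   form of the Hahn-Banach theorem for convex cones ([epi_cone_form]). *)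

Set Implicit Arguments.
Unset Strict Implicit.
Unset Printing Implicit Defensive.

Import Order.TTheory GRing.Theory Num.Theory.
Import numFieldNormedType.Exports.

Local Open Scope classical_set_scope.
Local Open Scope ring_scope.
Local Open Scope ereal_scope.

(** * The Hahn-Banach theorem for cones *)

Section HahnBanach.
Local Open Scope ring_scope.
Context {R : realType} {V : lmodType R}.
Implicit Types (A B P Q : set (V * R)%type) (x y : V) (a b c r s : R).

(** The model is the epigraph of a sublinear functional; the last condition is
   what a linear form lying below the cone imposes on it. *)
Definition epi_cone P :=
  [/\ P (0, 0),
      forall x y a b, P (x, a) -> P (y, b) -> P (x + y, a + b),
      forall r x a, 0 < r -> P (x, a) -> P (r *: x, r * a) &
      forall a, P (0, a) -> 0 <= a].

Let adjoin P x c : set (V * R)%type :=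
  [set z | exists y a s, P (y, a) /\ z = (y + s *: x, a + s * c)].

Let adjoin_epi_cone P x c : epi_cone P -> (forall a, P (x, a) -> c <= a) ->
  (forall a, P (- x, a) -> - c <= a) -> epi_cone (adjoin P x c).
Proof.
move=> [P0 PD PZ P0ge] cx cNx; split.
- by exists 0, 0, 0; rewrite scale0r mul0r !addr0.
- move=> _ _ _ _ [y [a [s [Py [-> ->]]]]] [z [b [t [Pz [-> ->]]]]].
  exists (y + z), (a + b), (s + t); split; first exact: PD.
  by rewrite scalerDl mulrDl; congr (_, _); rewrite addrACA.
- move=> r _ _ r0 [y [a [s [Py [-> ->]]]]].
  exists (r *: y), (r * a), (r * s); split; first exact: PZ.
  by rewrite scalerDr mulrDr scalerA mulrA.
- move=> _ [y [a [s [Py [/esym/eqP + ->]]]]]; rewrite addr_eq0 => /eqP yE.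
  have [s0|s0|s0] := ltgtP s 0.
  + have sV : 0 < - s^-1 by rewrite oppr_gt0 invr_lt0.
    have := PZ _ _ _ sV Py; rewrite yE scalerN scaleNr opprK scalerA.
    rewrite mulVf ?lt_eqF// scale1r => /cx.
    by rewrite -invrN ler_pdivlMl ?oppr_gt0// mulNr -subr_ge0 opprK.
  + have sV : 0 < s^-1 by rewrite invr_gt0.
    have := PZ _ _ _ sV Py; rewrite yE scalerN scalerA mulVf ?gt_eqF//.
    rewrite scale1r => /cNx; rewrite ler_pdivlMl// mulrN -subr_ge0 opprK.
    by [].
  + by move: Py; rewrite yE s0 scale0r oppr0 mul0r addr0; exact: P0ge.
Qed.


(** Hahn-Banach in epigraph form. By Zorn's lemma, the cone is contained in a
   maximal one [Q]. Adjoining to [Q] the line spanned by [(x, c)], for [c] the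
   infimum of the [a] with [Q (x, a)], again gives such a cone, so [Q] contains
   this line already: it is the epigraph of a linear form. *)
Lemma epi_cone_form P : epi_cone P -> (forall x, exists a, P (x, a)) ->
  exists l : {scalar V}, forall x a, P (x, a) -> l x <= a.
Proof.
move=> Pcone Pdom.
(* The union with [P] makes the empty chain harmless in Zorn's lemma. *)
have [A [Acone Amax]] :
    exists A, epi_cone (A `|` P) /\ forall B, A `<` B -> ~ epi_cone (B `|` P).
  apply: (@Zorn_bigcup (V * R)%type (fun A => epi_cone (A `|` P))) => F Fc Ft.
  have [->|/set0P[A0 FA0]] := eqVneq F set0; first by rewrite bigcup_set0 set0U.
  have up z : (\bigcup_(X in F) X `|` P) z -> exists2 X, F X & (X `|` P) z.
    by case=> [[X FX Xz]|Pz]; [exists X => //; left|exists A0 => //; right].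
  have inc X z : F X -> (X `|` P) z -> (\bigcup_(X in F) X `|` P) z.
    by move=> FX [Xz|Pz]; [left; exists X|right].
  split.
  - by right; case: Pcone.
  - move=> x y a b /up[X FX Xz] /up[Y FY Yz].
    have [XY|YX] := Ft _ _ FX FY.
      apply: (inc _ _ FY); have [_ h _ _] := Fc _ FY; apply: h => //.
      by case: Xz => [/XY|]; [left|right].
    apply: (inc _ _ FX); have [_ h _ _] := Fc _ FX; apply: h => //.
    by case: Yz => [/YX|]; [left|right].
  - move=> r x a r0 /up[X FX Xz]; apply: (inc _ _ FX).
    by have [_ _ h _] := Fc _ FX; exact: h.
  - by move=> a /up[X FX Xz]; have [_ _ _ h] := Fc _ FX; exact: h.
pose Q := A `|` P; have [Q0 QD QZ Q0ge] := Acone.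
have Qdom x : exists a, Q (x, a) by have [a Pa] := Pdom x; exists a; right.
have Qmax B : Q `<=` B -> epi_cone B -> B `<=` Q.
  move=> QB Bc z Bz; apply: contrapT => nQz; apply: (Amax B).
    split; first by move=> y Ay; apply: QB; left.
    by move=> h; apply: nQz; left; exact: h.
  suff -> : B `|` P = B by [].
  by apply/setUidl => y Py; apply: QB; right.
have line x : exists c, Q (x, c) /\ Q (- x, - c).
  pose S := [set a | Q (x, a)].
  have [b Qb] := Qdom (- x).
  have lbS a : S a -> - b <= a.
    move=> Qa; rewrite -subr_ge0 opprK; apply: Q0ge.
    by rewrite -(addrN x); exact: QD.
  have S0 : S !=set0 by exact: Qdom.
  have Scinf : has_inf S by split => //; exists (- b).
  pose c := inf S.
  have Bc : epi_cone (adjoin Q x c).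
    apply: adjoin_epi_cone => // a Qa; first by apply: ge_inf => //; case: Scinf.
    rewrite lerNl; apply: lb_le_inf => // e Qe.
    rewrite -subr_ge0 opprK addrC; apply: Q0ge.
    by rewrite -(addrN x) addrC; apply: QD.
  have QB : Q `<=` adjoin Q x c.
    by move=> [y a] Qy; exists y, a, 0; rewrite scale0r mul0r !addr0.
  exists c; split; apply: (Qmax _ QB Bc).
    by exists 0, 0, 1; rewrite scale1r mul1r !add0r.
  by exists 0, 0, (- 1); rewrite scaleN1r mulN1r !add0r.
have [l ll] := choice line.
have luniq x c : Q (x, c) -> Q (- x, - c) -> l x = c.
  move=> h1 h2; have [g1 g2] := ll x; apply/eqP; rewrite eq_le.
  by apply/andP; split; rewrite -subr_ge0; apply: Q0ge; rewrite -(addrN x);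
    apply: QD.
have lD x y : l (x + y) = l x + l y.
  have [[g1 g2] [h1 h2]] := (ll x, ll y).
  by apply: luniq; [exact: QD|rewrite !opprD; exact: QD].
have lN x : l (- x) = - l x.
  by have [g1 g2] := ll x; apply: luniq => //; rewrite !opprK.
have lp r x : 0 < r -> l (r *: x) = r * l x.
  move=> r0; have [g1 g2] := ll x; apply: luniq; first exact: QZ.
  by rewrite -scalerN -mulrN; apply: QZ.
have lZ r x : l (r *: x) = r * l x.
  have [r0|/lp//|->] := ltgtP r 0; last first.
    by rewrite scale0r mul0r; apply: luniq; rewrite ?oppr0.
  by rewrite -[r]opprK scaleNr lN lp ?oppr_gt0// !mulNr.
have lin : scalar l by move=> r x y; rewrite lD lZ.
pose L := GRing.isLinear.Build _ _ _ _ l lin.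
pose ls : {scalar V} := HB.pack l L.
exists ls => x a Pa; have [_ g2] := ll x; rewrite -subr_ge0.
by apply: Q0ge; rewrite -(addrN x); apply: QD => //; right.
Qed.

End HahnBanach.

(** * Upper and lower limits, cubes and rates *)

Section ExtendedLimits.
Context {R : realType}.
Implicit Types (u : nat -> \bar R) (a : \bar R).

Lemma lt_limn_esup u a m : a < limn_esup u -> exists2 n, (m <= n)%N & a < u n.
Proof.
rewrite ltNge => /negP alt; apply: contrapT => h; apply: alt.
apply: (@le_trans _ _ (ereal_sup (u @` [set n | (m <= n)%N]))).
  by apply: ereal_inf_lbound; exists [set n | (m <= n)%N] => //; exists m.
apply: ge_ereal_sup => _ [n /= mn <-]; rewrite leNgt; apply/negP => aun.
by apply: h; exists n.
Qed.

Lemma limn_esup_le u a m : (forall n, (m <= n)%N -> u n <= a) -> limn_esup u <= a.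
Proof.
move=> h; rewrite leNgt; apply/negP => /(lt_limn_esup m)[n mn].
by rewrite ltNge h.
Qed.

Lemma limn_einf_lt u a m : limn_einf u < a -> exists2 n, (m <= n)%N & u n < a.
Proof.
rewrite /limn_einf lteNl => /(lt_limn_esup m)[n mn]; rewrite lteN2 => una.
by exists n.
Qed.

Lemma le_limn_einf u a m : (forall n, (m <= n)%N -> a <= u n) -> a <= limn_einf u.
Proof.
move=> h; rewrite leNgt; apply/negP => /(limn_einf_lt m)[n mn].
by rewrite ltNge h.
Qed.

Lemma limn_esup_lt u a : limn_esup u < a ->
  exists m, forall n, (m <= n)%N -> u n < a.
Proof.
move=> /ereal_inf_lt[_ [V [m _ mV] <-] Va]; exists m => n mn.
by apply: le_lt_trans Va; apply: ereal_sup_ubound; exists n => //; exact: mV.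
Qed.

Lemma lt_limn_einf u a : a < limn_einf u ->
  exists m, forall n, (m <= n)%N -> a < u n.
Proof.
rewrite /limn_einf lteNr => /limn_esup_lt[m h]; exists m => n /h.
by rewrite lteN2.
Qed.

End ExtendedLimits.

Section Cubes.
Context {d : nat}.
Local Notation Zd := 'rV[int]_d.
Implicit Types (z w : Zd) (n m h : nat).

Lemma in_cube n w : (w \in cube n) = [forall i, (0 <= w ord0 i < n%:Z)%R].
Proof.
apply/imfsetP/forallP => [[/= v _ ->] i|h].
  by rewrite mxE /=; have := ltn_ord (v ord0 i); lia.
have lt i : (`|w ord0 i|%N < n)%N by have := h i; lia.
exists (\row_i Ordinal (lt i)); first by rewrite inE.
by apply/rowP => i; rewrite !mxE /= -[0%R]/ord0; have := h i; lia.
Qed.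

Lemma card_cube n : #|` @cube d n|%fset = (n ^ d)%N.
Proof.
rewrite /cube card_imfset /=; last first.
  move=> u v /rowP uv; apply/rowP => i; have := uv i; rewrite !mxE => -[].
  exact: val_inj.
by rewrite -cardE cardsT card_mx card_ord mul1n.
Qed.

Lemma card_fshift z (S : {fset Zd}) : #|` fshift z S|%fset = #|` S|%fset.
Proof. by rewrite card_imfset //=; exact: addIr. Qed.

Lemma in_fshift z w (S : {fset Zd}) : (w \in fshift z S) = ((w - z)%R \in S).
Proof.
apply/imfsetP/idP => [[v /= vS ->]|wS]; first by rewrite addrK.
by exists (w - z)%R => //; rewrite subrK.
Qed.

Lemma Lambda_cube n : (0 < n)%N -> (Lambda n : {fset Zd}) = cube n.
Proof. by move=> n0 /=; rewrite prednK. Qed.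

Lemma card_Lambda n : (0 < n)%N -> #|` (Lambda n : {fset Zd})|%fset = (n ^ d)%N.
Proof. by move=> n0; rewrite Lambda_cube // card_cube. Qed.

End Cubes.

Section Rate.
Context {R : realType} (d : nat).
Implicit Types (n : nat) (a : R) (x : \bar R).

Lemma card_Lambda_gt0 n : (0 < #|` (@Lambda d n : {fset _})|%fset%:R :> R)%R.
Proof. by rewrite ltr0n /= card_cube expn_gt0. Qed.

(** Rates are compared to real numbers at the exponential scale, so that the
   logarithms of 0 and of [+oo] need no separate treatment. *)
Lemma le_rate n a x : 0 <= x ->
  (a%:E <= rate d n x) =
  ((expR (#|` (@Lambda d n : {fset _})|%fset%:R * a))%:E <= x).
Proof.
move=> x0; have N0 := card_Lambda_gt0 n; rewrite /rate.
set N := (_%:R : R) in N0 *.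
rewrite lee_pdivlMl // -EFinM -[X in _ = (X <= _)]/(expeR (N * a)%:E).
rewrite -[in RHS](@lneK _ x); last by rewrite in_itv /= x0 leey.
by rewrite lee_expeR.
Qed.

Lemma rate_lt n a x : 0 <= x ->
  (rate d n x < a%:E) =
  (x < (expR (#|` (@Lambda d n : {fset _})|%fset%:R * a))%:E).
Proof. by move=> x0; rewrite !ltNge le_rate. Qed.

Lemma lt_rate n a x : 0 <= x ->
  (a%:E < rate d n x) =
  ((expR (#|` (@Lambda d n : {fset _})|%fset%:R * a))%:E < x).
Proof.
move=> x0; have N0 := card_Lambda_gt0 n; rewrite /rate.
set N := (_%:R : R) in N0 *.
rewrite lte_pdivlMl // -EFinM -[X in _ = (X < _)]/(expeR (N * a)%:E).
rewrite -[in RHS](@lneK _ x); last by rewrite in_itv /= x0 leey.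
by rewrite lte_expeR.
Qed.

Lemma rate_le n a x : 0 <= x ->
  (rate d n x <= a%:E) =
  (x <= (expR (#|` (@Lambda d n : {fset _})|%fset%:R * a))%:E).
Proof. by move=> x0; rewrite !leNgt lt_rate. Qed.

Lemma rate_le0 n x : x <= 1 -> rate d n x <= 0.
Proof.
by move=> x1; rewrite /rate pmule_rle0 ?lne_le0 // lte_fin invr_gt0 card_Lambda_gt0.
Qed.

Lemma rate_mono n x y : 0 <= x -> x <= y -> rate d n x <= rate d n y.
Proof.
move=> x0 xy; rewrite /rate lee_pmul2l // ?lte_fin ?invr_gt0 ?card_Lambda_gt0 //.
by rewrite lee_lne // in_itv /= ?leey ?x0 // (le_trans x0).
Qed.

End Rate.

(** * Packing cubes into a cube *)

Section Packing.
Context {d : nat}.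
Local Notation Zd := 'rV[int]_d.
Variables (n h m N : nat).
Hypotheses (nh : (n < h)%N) (hmN : (h * m <= N)%N).
Implicit Types (z w : Zd) (j : 'rV['I_m]_d).

Definition corner j : Zd := map_mx (fun k : 'I_m => (h * k)%N%:Z) j.

Definition block j : {fset Zd} := fshift (corner j) (cube n).

Definition leftover : {fset Zd} :=
  [fset z in cube N | [forall j, z \notin block j]]%fset.

Lemma in_block j w :
  (w \in block j) = [forall i, ((h * j ord0 i)%N%:Z <= w ord0 i < (h * j ord0 i + n)%N%:Z)%R].
Proof.
clear nh hmN.
rewrite in_fshift in_cube; apply: eq_forallb => i; rewrite !mxE /=; lia.
Qed.

Lemma block_sub j : (block j `<=` cube N)%fset.
Proof.
apply/fsubsetP => w; rewrite in_block in_cube => /forallP H.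
apply/forallP => i; have := H i; have := ltn_ord (j ord0 i); nia.
Qed.

Lemma leftover_sub : (leftover `<=` cube N)%fset.
Proof. by apply/fsubsetP => w; rewrite !inE => /andP[]. Qed.

Lemma block_leftover j z : z \in leftover -> z \notin block j.
Proof. by rewrite !inE => /andP[_ /forallP]. Qed.

(** The gaps of the grid exceed the decoupling distance. *)
Lemma zdist_block j j' w w' : j != j' -> w \in block j -> w' \in block j' ->
  (h - n <= zdist w w')%N.
Proof.
clear hmN.
move=> jj'; rewrite !in_block => /forallP H /forallP H'.
have [i ij] : exists i, j ord0 i != j' ord0 i.
  apply/existsP; apply: contraR jj'; rewrite negb_exists => /forallP jj.
  by apply/eqP/rowP => i; apply/eqP; have := jj i; rewrite negbK.
apply: leq_trans (leq_bigmax i).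
move: ij (H i) (H' i); rewrite -val_eqE /=; nia.
Qed.

Lemma zdist_shift z w w' : zdist (w - z)%R (w' - z)%R = zdist w w'.
Proof. by apply: eq_bigr => i _; rewrite !mxE; congr absz; ring. Qed.

Lemma sum_blocks (V : nmodType) (f : Zd -> V) :
  (\sum_(z <- cube N) f z =
   \sum_j \sum_(z <- block j) f z + \sum_(z <- leftover) f z)%R.
Proof.
rewrite (bigID (fun z => [exists j, z \in block j])) /=; congr (_ + _)%R.
  transitivity (\sum_j \sum_(z <- cube N | z \in block j) f z)%R; last first.
    apply: eq_bigr => j _; rewrite [LHS]big_fset_condE; apply: eq_fbigl => z.
    rewrite !inE /=; apply/andP/idP => [[]//|zj]; split => //.
    by apply: fsubsetP zj; exact: block_sub.
  rewrite (exchange_big_dep predT) //= big_mkcond /=; apply: eq_bigr => z _.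
  case: ifPn => [/existsP[j zj]|]; last first.
    by rewrite negb_exists => /forallP zj; rewrite big1 // => j /(negP (zj j)).
  rewrite (big_pred1 j) // => j' /=; apply/idP/eqP => [zj'|->//].
  apply/eqP; apply: contraT => jj'; have := zdist_block jj' zj' zj.
  rewrite /zdist big1; last by move=> i _; rewrite subrr.
  by rewrite leqn0 subn_eq0 leqNgt nh.
rewrite big_fset_condE; apply: eq_fbigl => z; rewrite !inE negb_exists; congr (_ && _).
Qed.

Lemma card_leftover : (#|` leftover|%fset + (m * n) ^ d = N ^ d)%N.
Proof.
have := sum_blocks (fun _ => 1%N); rewrite -!card_fset_sum1 card_cube.
under eq_bigr do rewrite -card_fset_sum1 card_fshift card_cube.
rewrite sum_nat_const card_mx card_ord mul1n => ->.
by rewrite expnMn addnC.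
Qed.

End Packing.

Section BlockSizes.
Local Open Scope ring_scope.
Context {R : realType} {d : nat}.
Implicit Types (g c : nat -> R) (e : R).

Lemma bernoulli e k : 0 <= e <= 1 -> 1 - k%:R * e <= (1 - e) ^+ k.
Proof.
move=> /andP[e0 e1]; elim: k => [|k IH]; first by rewrite mul0r subr0 expr0.
rewrite exprS; apply: le_trans (ler_wpM2l _ IH); last by lra.
have k0 : 0 <= k%:R :> R by []; rewrite -natr1; nra.
Qed.

Lemma eventually_small g e : (g m / m%:R) @[m --> \oo] --> (0 : R) -> 0 < e ->
  exists n0, forall n, (n0 <= n)%N -> (0 < n)%N -> g n <= e * n%:R.
Proof.
move=> /cvgrPdist_le /(_ _) h e0; have [n0 _ hn] := h e e0.
exists n0 => n /hn /=; rewrite sub0r normrN => hh n1.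
rewrite -ler_pdivrMr ?ltr0n //; apply: le_trans hh; exact: ler_norm.
Qed.

(** Blocks of side [n] on a grid of mesh [h] a little larger than [n + g n]
   cover a proportion close to 1 of a cube of large side. *)
Lemma block_sizes g c e : (0 < d)%N -> 0 < e -> (forall m, (0 < m)%N -> 0 <= g m) ->
  (g m / m%:R) @[m --> \oo] --> (0 : R) ->
  (c m / #|` @cube d m|%fset%:R) @[m --> \oo] --> (0 : R) ->
  exists n0, forall n, (n0 <= n)%N ->
    [/\ (0 < n)%N, c n <= e * (n ^ d)%:R &
      exists h, n%:R + g n < h%:R /\ exists N0, forall N, (N0 <= N)%N ->
        (0 < N)%N /\ (N ^ d)%:R - ((N %/ h * n) ^ d)%:R <= e * (N ^ d)%:R].
Proof.
move=> d0 e0 g0 gm cm.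
pose eta := Num.min (e / d%:R) 1.
have d0R : 0 < d%:R :> R by rewrite ltr0n.
have eta0 : 0 < eta by rewrite lt_min divr_gt0 //= ltr01.
have eta1 : eta <= 1 by rewrite ge_min lexx orbT.
have etae : d%:R * eta <= e.
  by rewrite mulrC -ler_pdivlMr // ge_min lexx.
have [n1 hg] := eventually_small gm (divr_gt0 eta0 (ltr0n R 4)).
have [n2 hc] : exists n0, forall n, (n0 <= n)%N -> (0 < n)%N -> c n <= e * (n ^ d)%:R.
  move/cvgrPdist_le : cm => /(_ _ e0)[n2 _ hn].
  exists n2 => n /hn /=; rewrite card_cube sub0r normrN => hh n1'.
  rewrite -ler_pdivrMr ?ltr0n ?expn_gt0 ?n1' //; apply: le_trans hh; exact: ler_norm.
(* [n >= 4 / eta] absorbs the rounding of [g n] to an integer. *)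
pose n3 := (Num.truncn (4 / eta)).+1.
exists (maxn n1 (maxn n2 n3)) => n; rewrite !geq_max => /and3P[n1n n2n n3n].
have np : (0 < n)%N by apply: leq_trans n3n.
have nbig : 4 <= eta * n%:R.
  rewrite mulrC -ler_pdivrMr //; apply: (@le_trans _ _ n3%:R); last first.
    by rewrite ler_nat.
  exact/ltW/truncnS_gt.
split => //; first exact: hc.
pose h := (n + (Num.truncn (g n)).+1)%N.
have gn0 := g0 _ np.
have gt1 : g n < (Num.truncn (g n)).+1%:R by exact: truncnS_gt.
have gt2 : (Num.truncn (g n))%:R <= g n by rewrite truncn_le.
have hn : n%:R + g n < h%:R by rewrite natrD ltrD2l.
have hle : h%:R <= (1 + eta / 2) * n%:R :> R.
  rewrite natrD -natr1 mulrDl mul1r lerD2l; have := hg _ n1n np.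
  by move: nbig gt2; lra.
exists h; split => //.
have h0 : (0 < h)%N by rewrite addn_gt0 np.
(* [N >= 2 n / eta] absorbs the remainder of the division of [N] by [h]. *)
pose N1 := (Num.truncn (2 * n%:R / eta)).+1.
exists N1 => N N1N; have Np : (0 < N)%N by apply: leq_trans N1N.
split => //.
have Nbig : 2 * n%:R <= eta * N%:R.
  rewrite [leRHS]mulrC -ler_pdivrMr //; apply: (@le_trans _ _ N1%:R); last first.
    by rewrite ler_nat.
  exact/ltW/truncnS_gt.
set m := (N %/ h)%N.
have mh : N%:R < (m%:R + 1) * h%:R :> R.
  rewrite natr1 -natrM ltr_nat {1}(divn_eq N h) mulSn addnC ltn_add2r.
  exact: ltn_pmod.
have nR : 0 < n%:R :> R by rewrite ltr0n.
have m0 : 0 <= m%:R :> R by [].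
have key : (1 - eta) * N%:R <= (m * n)%:R.
  rewrite natrM.
  have A : N%:R <= (m%:R + 1) * ((1 + eta / 2) * n%:R).
    apply/ltW/(lt_le_trans mh)/ler_wpM2l => //; lra.
  have B : (1 - eta / 2) * N%:R <= (m%:R + 1) * n%:R.
    have := ler_wpM2l (_ : 0 <= 1 - eta / 2) A => /(_ ltac:(lra)) A'.
    apply: (le_trans A').
    rewrite mulrCA ler_wpM2l ?addr_ge0 // mulrA ler_piMl //.
    nra.
  lra.
have NR : 0 <= N%:R :> R by [].
have : ((1 - eta) * N%:R) ^+ d <= (m * n)%:R ^+ d.
  by apply: lerXn2r => //; rewrite ?nnegrE ?mulr_ge0 ?subr_ge0.
rewrite exprMn -!natrX => le1.
rewrite lerBlDr -lerBlDl.
apply: le_trans le1; rewrite -{1}[(N ^ d)%:R]mul1r -mulrBl.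
apply: ler_wpM2r => //.
apply: (@le_trans _ _ (1 - d%:R * eta)); first by rewrite lerD2l lerN2.
by apply: bernoulli; rewrite ltW.
Qed.

End BlockSizes.

(** * Local sigma-algebras and local control *)

Section Decoupling.
Context {R : realType} {X : tvsType R} {F : set (set X)} {d : nat}.
Local Notation Zd := 'rV[int]_d.
Local Notation config := (Zd -> X).
Hypothesis hF : sigma_algebra [set: X] F.
Implicit Types (S T : {fset Zd}) (L : box d) (z : Zd) (A B : set config) (G : set X).

Lemma measTypeE : @measurable _ (measType F) = F.
Proof. exact: sigma_algebra_id. Qed.

Lemma measurable_measType (G : set X) : F G -> @measurable _ (measType F) G.
Proof. exact: sub_gen_smallest. Qed.

Lemma sigma_loc_sub S T A : (S `<=` T)%fset -> sigma_loc F S A -> sigma_loc F T A.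
Proof.
move=> ST; apply: sub_smallest2r; first exact: smallest_sigma_algebra.
by move=> {}A [L /= LS FA]; exists L => //=; exact: fsubset_trans ST.
Qed.

Lemma sigma_locI S A B : sigma_loc F S A -> sigma_loc F S B -> sigma_loc F S (A `&` B).
Proof. exact: (@measurableI _ (locType F S)). Qed.

Lemma sigma_locT S : sigma_loc F S [set: config].
Proof. exact: (@measurableT _ (locType F S)). Qed.

Lemma sigma_loc_mean S L G : (L `<=` S)%fset -> F G ->
  sigma_loc F S [set s | G (mean L s)].
Proof.
move=> LS FG; apply: sub_gen_smallest; exists L => //.
by exists G => //; rewrite setTI.
Qed.

Lemma mean_shift z (S : {fset Zd}) (s : config) :
  mean S (fun w => s (w + z)%R) = mean (fshift z S) s.
Proof.
rewrite /mean card_fshift; congr (_ *: _)%R.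
rewrite /fshift big_imfset //= => u v _ _; exact: addIr.
Qed.

Lemma shift_configE z A : shift_config z A = [set s | A (fun w => s (w + z)%R)].
Proof.
apply/seteqP; split => [_ [s As <-]|s As] /=.
  by congr A: As; apply/funext => w; rewrite addrK.
by exists (fun w => s (w + z)%R) => //; apply/funext => w; rewrite subrK.
Qed.

Lemma sigma_loc_shift z S A : sigma_loc F S A ->
  sigma_loc F (fshift z S) (shift_config z A).
Proof.
move=> FA; pose f : locType F (fshift z S) -> locType F S := fun s w => s (w + z)%R.
have mf : measurable_fun setT f.
  apply: (@measurability _ _ _ _ setT f (mean_sets F S)) => //.
  move=> _ [_ [L LS [G FG <-]] <-]; rewrite !setTI.
  rewrite (_ : f @^-1` _ = [set s | G (mean (shift_box z L) s)]).
    apply: (@sigma_loc_mean _ (shift_box z L)) => //; apply/fsubsetP => w.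
    by rewrite /= !in_fshift; apply: (fsubsetP LS).
  by apply/seteqP; split => s /=; rewrite -mean_shift.
by rewrite shift_configE -[X in sigma_loc _ _ X]setTI; exact: mf.
Qed.

Lemma box1E z : (shift_box z (Lambda 1) : {fset Zd}) = [fset z]%fset.
Proof.
apply/fsetP => w; rewrite /= in_fshift in_cube in_fset1.
apply/forallP/eqP => [h|-> i]; last by rewrite !mxE subrr.
by apply/rowP => i; have := h i; rewrite !mxE /= -[(0%R : 'I_1)]/ord0; lia.
Qed.

Lemma sigma_loc_site S z G : z \in S -> F G -> sigma_loc F S [set s | G (s z)].
Proof.
move=> zS FG; rewrite (_ : [set _ | _] = [set s | G (mean (shift_box z (Lambda 1)) s)]).
  by apply: (@sigma_loc_mean _ (shift_box z (Lambda 1))) => //; rewrite box1E fsub1set.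
apply: eq_set => s; congr G.
by rewrite /mean box1E big_seq_fset1 cardfs1 invr1 scale1r.
Qed.

Lemma sigma_loc_sites S (t : seq Zd) G : {subset t <= S} -> F G ->
  sigma_loc F S [set s | forall z, z \in t -> G (s z)].
Proof.
move=> tS FG; elim: t tS => [|z t IH] tS.
  by rewrite (_ : [set _ | _] = setT); [exact: sigma_locT|apply/seteqP; split].
rewrite (_ : [set _ | _] = [set s | G (s z)] `&` [set s | forall z, z \in t -> G (s z)]).
  apply: sigma_locI; first by apply: sigma_loc_site => //; apply: tS; exact: mem_head.
  by apply: IH => w wt; apply: tS; rewrite inE wt orbT.
apply/seteqP; split=> s /=.
  by move=> h; split=> [|w wt]; apply: h; rewrite inE ?eqxx ?wt ?orbT.
by move=> [Gz Gt] w /[!inE] /orP[/eqP->//|]; exact: Gt.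
Qed.

Variable mu : forall L : box d, probability (locType F L) R.
Hypothesis hmu : scit mu.

Lemma mu_sub L L' A : (L `<=` L')%fset -> sigma_loc F L A -> mu L' A = mu L A.
Proof. by move=> LL'; apply: hmu.1. Qed.

Lemma mu_shift z L A : sigma_loc F L A ->
  mu (shift_box z L) (shift_config z A) = mu L A.
Proof. exact: hmu.2. Qed.

Lemma cramerE n G : cramer mu n G = mu (Lambda n) [set s | G (mean (Lambda n) s)].
Proof. by []. Qed.

(** [P(s 0 \in G | F_(L \ 0)) >= a] for all boxes [L], in the integrated form in
   which conditional probabilities are used below. *)
Definition site_ge G (a : R) := F G /\
  forall L B, 0%R \in (L : {fset Zd}) -> sigma_loc F (L `\ 0%R)%fset B ->
    a%:E * mu L B <= mu L ([set s : config | G (s 0%R)] `&` B).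

Lemma cond_prob_ge_site G (a : R) : F G ->
  (forall L, 0%R \in (L : {fset Zd}) ->
    cond_prob_ge (mu L) (sigma_loc F (L `\ 0%R)%fset) [set s : config | G (s 0%R)] a) ->
  site_ge G a.
Proof.
move=> FG h; split => // L B L0 FB.
have [f [_ fint fB] [N [mN N0 fN]]] := h L L0.
have mB : measurable (B : set (locType F L)).
  by apply: sigma_loc_sub FB; exact: fsubsetDl.
have mBN : measurable (B `\` N : set (locType F L)) by exact: measurableD.
have aint (D : set (locType F L)) : measurable D -> (mu L).-integrable D (cst a%:E).
  by move=> mD; exact: finite_measure_integrable_cst.
have fint' (D : set (locType F L)) : measurable D -> (mu L).-integrable D (EFin \o f).
  by move=> mD; exact: integrableS fint.
rewrite -fB // -integral_cst // (negligible_integral mN mB (aint _ mB) N0).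
rewrite [leRHS](negligible_integral mN mB (fint' _ mB) N0).
apply: le_integral; [exact: mBN|exact: aint|exact: fint'|].
move=> s /set_mem[_ Ns]; rewrite lee_fin; apply: contrapT => afs.
by apply: Ns; apply: fN.
Qed.

(** Translation invariance moves the condition at the origin to any site. *)
Lemma site_ge_at G (a : R) L z B : site_ge G a -> z \in (L : {fset Zd}) ->
  sigma_loc F (L `\ z)%fset B ->
  a%:E * mu L B <= mu L ([set s : config | G (s z)] `&` B).
Proof.
move=> [FG h] zL FB.
have FBL : sigma_loc F L B by apply: sigma_loc_sub FB; exact: fsubsetDl.
have FGz : sigma_loc F L [set s : config | G (s z)] by exact: sigma_loc_site.
rewrite -(mu_shift (- z)%R FBL) -(mu_shift (- z)%R (sigma_locI FGz FBL)).
rewrite (_ : shift_config _ (_ `&` _) =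
    [set s : config | G (s 0%R)] `&` shift_config (- z)%R B); last first.
  by rewrite !shift_configE; apply/seteqP; split => s /=; rewrite subrr.
apply: h; first by rewrite /= in_fshift sub0r opprK.
apply: (sigma_loc_sub _ (sigma_loc_shift FB)).
apply/fsubsetP => w; rewrite in_fsetD1 /= !in_fshift opprK in_fsetD1 => /andP[wz ->].
by rewrite andbT; apply: contra wz => /eqP ->; rewrite add0r.
Qed.

(** Lower bounds for conditional probabilities add up as for probabilities:
   [P(G & K) >= P(G) - P(not K)]. *)
Lemma site_geI G K (a b : R) : site_ge G a -> site_ge K (1 - b) ->
  site_ge (G `&` K) (a - b).
Proof.
move=> [FG hG] [FK hK]; have FGK : F (G `&` K).
  by have := @measurableI _ (measType F) G K; rewrite measTypeE; apply.
split => // L B L0 FB.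
have FBL : sigma_loc F L B by apply: sigma_loc_sub FB; exact: fsubsetDl.
have FGB : sigma_loc F L ([set s : config | G (s 0%R)] `&` B).
  by apply: sigma_locI => //; exact: sigma_loc_site.
have FKB : sigma_loc F L ([set s : config | K (s 0%R)] `&` B).
  by apply: sigma_locI => //; exact: sigma_loc_site.
have := hG L B L0 FB; have := hK L B L0 FB.
set GB := _ `&` B in FGB *; set KB := _ `&` B in FKB *.
rewrite (_ : [set s : config | (G `&` K) (s 0%R)] `&` B = GB `&` KB); last first.
  by apply/seteqP; split => s /=; rewrite /GB /KB /=; tauto.
have FI : sigma_loc F L (GB `&` KB) by exact: sigma_locI.
have : mu L GB + mu L KB <= mu L B + mu L (GB `&` KB).
  rewrite (measureDI (mu L) FGB FKB).
  rewrite addeAC leeD2r // -measureU //; first last.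
  - by apply/seteqP; split => s //= [[_ nKB] /nKB].
  - exact: (@measurableD _ (locType F L)).
  apply: le_measure; rewrite ?inE //.
  - by apply: (@measurableU _ (locType F L)) => //; exact: (@measurableD _ (locType F L)).
  - by move=> s [[[]]|[]].
rewrite -(@fineK _ (mu L B)) ?fin_num_measure // -(@fineK _ (mu L GB)) ?fin_num_measure //.
rewrite -(@fineK _ (mu L KB)) ?fin_num_measure // -(@fineK _ (mu L (GB `&` KB))) ?fin_num_measure //.
rewrite -!EFinM -!EFinD !lee_fin; lra.
Qed.

Lemma fset_seqD (L S : {fset Zd}) z : (S `<=` L)%fset -> z \notin S ->
  (S `<=` L `\ z)%fset.
Proof. by move=> SL zS; rewrite fsubsetD1 SL. Qed.

(** The sites are prescribed one at a time, each one conditionally on all the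
   others. *)
Lemma sites_ge G (a : R) L S B (t : seq Zd) : site_ge G a -> (0 <= a)%R ->
  uniq t -> {subset t <= (L : {fset Zd})} -> (forall z, z \in t -> z \notin S) ->
  (S `<=` L)%fset -> sigma_loc F S B ->
  (a ^+ size t)%:E * mu L B <=
    mu L ([set s | forall z, z \in t -> G (s z)] `&` B).
Proof.
move=> Ga a0; have FG := Ga.1; elim: t => [|z t IH] /=.
  move=> _ _ _ SL FB; rewrite expr0 mul1e le_measure ?inE //.
  - exact: sigma_loc_sub FB.
  - apply: sigma_locI; last exact: sigma_loc_sub FB.
    by apply: sigma_loc_sites.
move=> /andP[zt ut] tL tS SL FB.
have tL' : {subset t <= (L : {fset Zd})} by move=> w wt; apply: tL; rewrite inE wt orbT.
have FE : sigma_loc F (L `\ z)%fset ([set s | forall z, z \in t -> G (s z)] `&` B).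
  apply: sigma_locI.
    apply: sigma_loc_sites => // w wt; rewrite in_fsetD1 tL' // andbT.
    by apply: contraNneq zt => <-.
  by apply: sigma_loc_sub FB; apply: fset_seqD => //; apply: tS; exact: mem_head.
have := site_ge_at Ga (tL _ (mem_head _ _)) FE.
rewrite setIA (_ : [set s : config | G (s z)] `&` _ =
    [set s | forall w, w \in z :: t -> G (s w)]); last first.
  apply/seteqP; split => s /=.
    by move=> [Gz Gt] w /[!inE] /orP[/eqP->//|]; exact: Gt.
  by move=> h; split=> [|w wt]; apply: h; rewrite inE ?eqxx ?wt ?orbT.
apply: le_trans; rewrite exprS EFinM -muleA lee_wpmul2l ?lee_fin //.
by apply: IH => // w wt; apply: tS; rewrite inE wt orbT.
Qed.

End Decoupling.

(** * Decoupling of blocks *)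

Section Blocks.
Context {R : realType} {X : tvsType R} {F : set (set X)} {d : nat}.
Local Notation Zd := 'rV[int]_d.
Local Notation config := (Zd -> X).
Hypothesis hF : sigma_algebra [set: X] F.
Variable mu : forall L : box d, probability (locType F L) R.
Hypothesis hmu : scit mu.
Variables g c : nat -> R.
Hypothesis adiP : forall (m : nat) (S : {fset Zd}) A B, (0 < m)%N ->
  sigma_loc F (cube m) A -> sigma_loc F S B ->
  (g m)%:E < set_dist R S (cube m) ->
  forall L' : box d, (cube m `<=` L')%fset -> (S `<=` L')%fset ->
    (expR (- c m))%:E * mu L' A * mu L' B <= mu L' (A `&` B).
Variables n h m N : nat.
Hypotheses (n0 : (0 < n)%N) (nh : (n < h)%N) (hmN : (h * m <= N)%N) (N0 : (0 < N)%N).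
Hypothesis gh : (n%:R + g n < h%:R)%R.
Local Notation J := 'rV['I_m]_d.
Implicit Types (j : J) (A : J -> set X) (G : set X).

Let block_box j : (shift_box (corner h j) (Lambda n) : {fset Zd}) = block n h j.
Proof. by rewrite /block -Lambda_cube. Qed.

Lemma sigma_loc_block (S : {fset Zd}) j G : (block n h j `<=` S)%fset -> F G ->
  sigma_loc F S [set s | G (mean (block n h j) s)].
Proof. by rewrite -block_box; exact: sigma_loc_mean. Qed.

Lemma sigma_loc_blocks (S : {fset Zd}) (t : seq J) A :
  (forall j, j \in t -> (block n h j `<=` S)%fset) -> (forall j, F (A j)) ->
  sigma_loc F S [set s | forall j, j \in t -> A j (mean (block n h j) s)].
Proof.
move=> tS FA; elim: t tS => [|j t IH] tS.
  by rewrite (_ : [set _ | _] = setT); [exact: sigma_locT|apply/seteqP; split].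
rewrite (_ : [set _ | _] = [set s | A j (mean (block n h j) s)] `&`
    [set s | forall i, i \in t -> A i (mean (block n h i) s)]).
  apply: sigma_locI; first by apply: sigma_loc_block => //; apply: tS; exact: mem_head.
  by apply: IH => i it; apply: tS; rewrite inE it orbT.
apply/seteqP; split=> s /=.
  by move=> H; split=> [|i it]; apply: H; rewrite inE ?eqxx ?it ?orbT.
by move=> [Gz Gt] i /[!inE] /orP[/eqP->//|]; exact: Gt.
Qed.

Let set_dist_blocks j (t : seq J) : j \notin t ->
  (g n)%:E < set_dist R (fshift (- corner h j)%R (\bigcup_(i <- t) block n h i)%fset) (cube n).
Proof.
move=> jt; apply: (@lt_le_trans _ _ ((h - n)%N%:R)%:E).
  by rewrite lte_fin natrB ?(ltnW nh) // ltrBrDl.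
apply: le_ereal_inf_tmp => _ [x /= xS [y /= yn <-]]; rewrite lee_fin ler_nat.
move: xS; rewrite in_fshift opprK => /bigfcupP[i /andP[it _] xi].
rewrite -(zdist_shift (- corner h j)%R) opprK.
apply: (zdist_block nh (j := i) (j' := j)) => //.
  by apply: contraNneq jt => <-.
by rewrite /block in_fshift addrK.
Qed.

(** The blocks are prescribed one at a time. Translating by the opposite of its
   corner brings the next block to the cube at the origin, which is decoupled
   from the union of the previous blocks. *)
Lemma blocks_ge A (q : J -> R) (t : seq J) : uniq t -> (forall j, F (A j)) ->
  (forall j, 0 <= q j)%R -> (forall j, (q j)%:E <= cramer mu n (A j)) ->
  (\prod_(j <- t) (expR (- c n) * q j))%:E <=
    mu (Lambda N) [set s | forall j, j \in t -> A j (mean (block n h j) s)].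
Proof.
move=> + FA q0 qA; elim: t => [|j t IH] /=.
  move=> _; rewrite big_nil (_ : [set _ | _] = setT) ?probability_setT //.
  by apply/seteqP; split.
move=> /andP[jt ut]; rewrite big_cons.
set Et := [set s | forall i, i \in t -> A i (mean (block n h i) s)] in IH.
set z := corner h j; pose L' := shift_box (- z)%R (Lambda N).
pose S := (\bigcup_(i <- t) block n h i)%fset.
have FEt S' : (forall i, i \in t -> (block n h i `<=` S')%fset) -> sigma_loc F S' Et.
  by move=> h'; exact: sigma_loc_blocks.
have blockN (i : J) : (block n h i `<=` (Lambda N : {fset Zd}))%fset.
  by rewrite (Lambda_cube N0); exact: (block_sub nh hmN i).
have FA' : sigma_loc F (cube n) [set s : config | A j (mean (cube n) s)].
  by rewrite -(Lambda_cube n0); exact: sigma_loc_mean.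
have nL' : (cube n `<=` L')%fset.
  apply/fsubsetP => w wn; rewrite /L' in_fshift opprK.
  by apply: (fsubsetP (blockN j)); rewrite /block in_fshift addrK.
have SL' : (fshift (- z)%R S `<=` L')%fset.
  apply/fsubsetP => w; rewrite /L' !in_fshift => wS.
  by apply: (fsubsetP _ _ wS); apply/bigfcupsP => i _ _; exact: blockN.
have FES : sigma_loc F S Et by apply: FEt => i it; exact: bigfcup_sup.
have FEN : sigma_loc F (Lambda N) Et by apply: FEt => i _; exact: blockN.
have FAN : sigma_loc F (Lambda N) [set s | A j (mean (block n h j) s)].
  exact: sigma_loc_block.
have FES' : sigma_loc F (fshift (- z)%R S) (shift_config (- z)%R Et).
  exact: sigma_loc_shift.
have := adiP n0 FA' FES' (set_dist_blocks jt) nL' SL'.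
rewrite (mu_shift hmu (- z)%R FEN).
have -> : mu L' [set s : config | A j (mean (cube n) s)] = cramer mu n (A j).
  rewrite cramerE -{1}(Lambda_cube n0); apply: mu_sub => //.
    by rewrite Lambda_cube.
  exact: sigma_loc_mean.
have -> : [set s : config | A j (mean (cube n) s)] `&` shift_config (- z)%R Et =
    shift_config (- z)%R ([set s | A j (mean (block n h j) s)] `&` Et).
  rewrite !shift_configE; apply/seteqP; split => s /= [H1 H2]; split => //; move: H1;
  rewrite mean_shift /block; congr (A j (mean _ _));
  by apply/fsetP => w; rewrite !in_fshift opprK -addrA ?subrr ?addNr ?addr0 // addrK.
rewrite (mu_shift hmu) //; last exact: sigma_locI.
have -> : [set s | A j (mean (block n h j) s)] `&` Et =
    [set s | forall i, i \in j :: t -> A i (mean (block n h i) s)].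
  apply/seteqP; split=> s /=.
    by move=> [Gz Gt] i /[!inE] /orP[/eqP->//|]; exact: Gt.
  by move=> H; split=> [|i it]; apply: H; rewrite inE ?eqxx ?it ?orbT.
apply: le_trans; rewrite EFinM EFinM lee_pmul ?IH // ?lee_fin ?mulr_ge0 ?expR_ge0 //.
  by apply: prodr_ge0 => i _; rewrite mulr_ge0 ?expR_ge0.
by rewrite lee_wpmul2l // lee_fin expR_ge0.
Qed.

(** Decoupling from below for the blocks, then local control for the remaining
   sites, which may be within the decoupling distance of the blocks. *)
Lemma decoupling A (q : J -> R) G (a : R) : (forall j, F (A j)) ->
  (forall j, 0 <= q j)%R -> (forall j, (q j)%:E <= cramer mu n (A j)) ->
  site_ge mu G a -> (0 <= a)%R ->
  (a ^+ #|` @leftover d n h m N|%fset * \prod_j (expR (- c n) * q j))%:E <=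
    mu (Lambda N) [set s | (forall j, A j (mean (block n h j) s)) /\
      (forall z, z \in @leftover d n h m N -> G (s z))].
Proof.
move=> FA q0 qA Ga a0.
pose S := (\bigcup_(j <- index_enum J) block n h j)%fset.
have NE := @Lambda_cube d _ N0.
have SN : (S `<=` (Lambda N : {fset Zd}))%fset.
  apply/bigfcupsP => i _ _; rewrite NE; exact: (block_sub nh hmN).
pose E := [set s | forall j, j \in index_enum J -> A j (mean (block n h j) s)].
have FE : sigma_loc F S E.
  by apply: sigma_loc_blocks => // j jJ; exact: bigfcup_sup.
have E1 : {subset @leftover d n h m N <= (Lambda N : {fset Zd})}.
  by move=> z zl; rewrite NE; apply: (fsubsetP (leftover_sub _ _ _ _)) zl.
have E2 z : z \in @leftover d n h m N -> z \notin S.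
  move=> zl; apply/bigfcupP => -[j _]; apply/negP.
  exact: (block_leftover j zl).
have := sites_ge hmu Ga a0 (fset_uniq _) E1 E2 SN FE.
rewrite (_ : [set s | forall z, z \in _ -> _] `&` E = [set s |
    (forall j, A j (mean (block n h j) s)) /\
    (forall z, z \in @leftover d n h m N -> G (s z))]); last first.
  apply/seteqP; split=> s /= [H1 H2]; split => //.
    by move=> j; apply: H2; rewrite mem_index_enum.
apply: le_trans; rewrite EFinM lee_wpmul2l ?lee_fin ?exprn_ge0 //.
exact: (blocks_ge (index_enum_uniq _)).
Qed.

Lemma mean_blocks (s : config) :
  (mean (Lambda N) s = ((N ^ d)%:R : R)^-1 *:
    (\sum_(j : J) ((n ^ d)%:R : R) *: mean (block n h j) s +
     \sum_(z <- @leftover d n h m N) s z))%R.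
Proof.
rewrite {1}/mean card_Lambda // Lambda_cube // (sum_blocks nh hmN).
congr (_ *: (_ + _))%R; apply: eq_bigr => j _.
rewrite /mean card_fshift card_cube scalerA divff ?scale1r //.
by rewrite pnatr_eq0 expn_eq0 negb_and -lt0n n0.
Qed.

End Blocks.

(** * Convex sets and seminorms *)

Section Seminorms.
Local Open Scope ring_scope.
Context {R : realType} {X : tvsType R}.
Implicit Types (p : X -> R) (x y z : X) (C D : set X) (r s t : R).

Definition seminorm p := [/\ forall x, 0 <= p x,
  forall x y, p (x + y) <= p x + p y & forall r x, p (r *: x) = `|r| * p x].

Definition sball p x r : set X := [set y | p (y - x) < r].

Lemma seminorm0 p : seminorm p -> p 0 = 0.
Proof. by move=> [_ _ pZ]; rewrite -(scale0r 0) pZ normr0 mul0r. Qed.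

Lemma seminormN p x : seminorm p -> p (- x) = p x.
Proof. by move=> [_ _ pZ]; rewrite -scaleN1r pZ normrN1 mul1r. Qed.

Lemma seminorm_sum p (I : Type) (s : seq I) (f : I -> X) : seminorm p ->
  p (\sum_(i <- s) f i) <= \sum_(i <- s) p (f i).
Proof.
move=> hp; elim: s => [|i s IH]; first by rewrite !big_nil seminorm0.
rewrite !big_cons; case: hp => _ pD _; apply: (le_trans (pD _ _)).
by rewrite lerD2l.
Qed.

Lemma convexP D : convex_set D <-> forall x y t, 0 <= t <= 1 -> D x -> D y ->
  D (t *: x + (1 - t) *: y).
Proof.
split=> [cD x y t /andP[t0 t1] Dx Dy|cD].
  have t01 : (0 <= t) && (t <= 1) by rewrite t0 t1.
  have := cD x y (Itv01 t0 t1) (mem_set Dx) (mem_set Dy).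
  by rewrite inE.
apply/convex_setW => x y /set_mem Dx /set_mem Dy k k0 k1; apply/mem_set.
by apply: cD => //; rewrite !ltW.
Qed.

Lemma convex_comb D (l : seq (R * X)) : convex_set D ->
  (forall q, q \in l -> 0 <= q.1 /\ D q.2) -> 0 < \sum_(q <- l) q.1 ->
  D ((\sum_(q <- l) q.1)^-1 *: \sum_(q <- l) q.1 *: q.2).
Proof.
move=> /convexP cD; elim: l => [|[w x] l IH] h; first by rewrite big_nil ltxx.
have [/= w0 Dx] := h _ (mem_head _ _).
have h' q : q \in l -> 0 <= q.1 /\ D q.2 by move=> ql; apply: h; rewrite inE ql orbT.
rewrite !big_cons /=; set W := \sum_(q <- l) q.1 in IH *.
set Z := \sum_(q <- l) _ in IH *.
have W0 : 0 <= W by rewrite /W big_seq; apply: sumr_ge0 => q /h'[].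
move: W0; rewrite le_eqVlt => /orP[/eqP W0|W0 wW].
  have ZE : Z = 0.
    rewrite /Z big_seq big1 // => q ql.
    have /eqP := W0; rewrite eq_sym /W big_seq psumr_eq0 => [/allP/(_ q ql)|q' /h'[]//].
    by rewrite ql /= => /eqP ->; rewrite scale0r.
  rewrite ZE -W0 !addr0 => w0'.
  by rewrite scalerA mulVf ?gt_eqF // scale1r.
have DZ := IH h' W0.
(* The barycentre of the first point and of the barycentre of the others. *)
have -> : (w + W)^-1 *: (w *: x + Z) =
    (w / (w + W)) *: x + (1 - w / (w + W)) *: (W^-1 *: Z).
  rewrite scalerDr !scalerA mulrC; congr (_ + _ *: _); field.
  by rewrite !gt_eqF.
apply: cD => //; apply/andP; split; first by rewrite divr_ge0 // ltW.
by rewrite ler_pdivrMr // mul1r lerDl ltW.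
Qed.

Lemma dilateP r C x : r != 0 -> dilate r C x <-> C (r^-1 *: x).
Proof.
move=> r0; split=> [[y Cy <-]|Cx]; first by rewrite scalerA mulVf // scale1r.
by exists (r^-1 *: x) => //; rewrite scalerA divff // scale1r.
Qed.

Lemma translateP x C y : translate x C y <-> C (y - x).
Proof.
split=> [[z Cz <-]|Cyx]; first by rewrite addrC addKr.
by exists (y - x) => //; rewrite addrC subrK.
Qed.

Lemma gauge_ge0 C x : (0 <= gauge C x)%E.
Proof. by apply: le_ereal_inf_tmp => _ [t [t0 _] <-]; rewrite lee_fin. Qed.

(** The seminorm is the gauge of [C], which is finite since [C] is internal. *)
Lemma internal_seminorm C : internal C -> dilate (-1) C = C ->
  exists2 p, seminorm p & C = [set x | p x < 1].
Proof.
move=> [cC fC CE] symC; pose p x := fine (gauge C x).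
have pE x : gauge C x = (p x)%:E.
  by rewrite fineK // fin_numE gt_eqF ?(lt_le_trans _ (gauge_ge0 _ _)) ?ltNye_eq //= lt_eqF.
have Cp x : C x <-> p x < 1 by rewrite {1}CE /= pE lte_fin.
have p0 x : 0 <= p x by rewrite -lee_fin -pE gauge_ge0.
have pub x t : 0 <= t -> dilate t C x -> p x <= t.
  by move=> t0 tx; rewrite -lee_fin -pE; apply: ereal_inf_lbound; exists t.
have plt x s : p x < s -> exists t, [/\ 0 <= t, t < s & dilate t C x].
  rewrite -lte_fin -pE => /ereal_inf_lt[_ [t [t0 tx] <-]]; rewrite lte_fin => ts.
  by exists t.
have pleZ r x : 0 < r -> p (r *: x) <= r * p x.
  move=> r0; rewrite leNgt; apply/negP => h.
  have /plt[t [t0 ts [y Cy yx]]] : p x < p (r *: x) / r by rewrite ltr_pdivlMr // mulrC.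
  have : p (r *: x) <= r * t.
    by apply: pub; [rewrite mulr_ge0 // ltW|exists y => //; rewrite -yx scalerA].
  by rewrite leNgt mulrC -ltr_pdivlMr // ts.
have pZ r x : 0 < r -> p (r *: x) = r * p x.
  move=> r0; apply/eqP; rewrite eq_le pleZ //=.
  rewrite -ler_pdivlMl //; have rV : 0 < r^-1 by rewrite invr_gt0.
  by have := pleZ _ (r *: x) rV; rewrite scalerA mulVf ?gt_eqF // scale1r.
have ltp x s : 0 < s -> (p x < s) = (p (s^-1 *: x) < 1).
  by move=> s0; rewrite pZ ?invr_gt0 // mulrC ltr_pdivrMr // mul1r.
have pD x y : p (x + y) <= p x + p y.
  apply/ler_addgt0Pr => e e0.
  have hx : p x < p x + e / 2 by rewrite ltrDl divr_gt0.
  have hy : p y < p y + e / 2 by rewrite ltrDl divr_gt0.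
  set s := p x + e / 2 in hx; set t := p y + e / 2 in hy.
  have s0 : 0 < s by apply: le_lt_trans hx.
  have t0 : 0 < t by apply: le_lt_trans hy.
  have -> : p x + p y + e = s + t by rewrite /s /t; lra.
  have st0 := addr_gt0 s0 t0; move: s t => s t in hx hy s0 t0 st0 *.
  apply/ltW; rewrite ltp //; apply/Cp.
  have -> : (s + t)^-1 *: (x + y) =
      (s / (s + t)) *: (s^-1 *: x) + (1 - s / (s + t)) *: (t^-1 *: y).
    by rewrite scalerDr !scalerA; congr (_ *: _ + _ *: _); field; rewrite !gt_eqF.
  have /convexP := cC; apply.
  - apply/andP; split; first by rewrite divr_ge0 // ltW.
    by rewrite ler_pdivrMr // mul1r lerDl ltW.
  - by apply/Cp; rewrite -ltp.
  - by apply/Cp; rewrite -ltp.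
have C0 : p 0 = 0.
  apply/eqP; rewrite eq_le p0 andbT; apply/ler_addgt0Pl => e e0; rewrite addr0.
  have := pZ _ 0 (ltr0n R 2); rewrite scaler0 => h.
  have : p 0 = 0 by lra.
  by move=> ->; rewrite ltW.
have pN x : p (- x) <= p x.
  apply/ler_addgt0Pr => e e0; have pe : p x < p x + e by rewrite ltrDl.
  have s0 := le_lt_trans (p0 x) pe; apply/ltW.
  move: pe; rewrite ltp // => /Cp Cx; rewrite ltp //; apply/Cp; rewrite -symC.
  by exists ((p x + e)^-1 *: x) => //; rewrite scaleN1r scalerN.
have pNE x : p (- x) = p x.
  by apply/eqP; rewrite eq_le pN -{1}(opprK x) pN.
exists p; last by apply/seteqP; split => x /Cp.
split => // r x; have [r0|r0|->] := ltgtP r 0.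
- by rewrite -[r]opprK scaleNr pNE pZ ?oppr_gt0 // ltr0_norm opprK.
- by rewrite pZ // gtr0_norm.
- by rewrite scale0r C0 normr0 mul0r.
Qed.

End Seminorms.

(** * Balls, entropy and packings *)

Section Adapted.
Context {R : realType} {X : tvsType R} {F C0 : set (set X)}.
Hypothesis hX : evlcm F C0.
Implicit Types (p : X -> R) (x y z : X) (r : R).

(** The seminorms whose open unit ball belongs to [C0]; they define the topology
   of [X]. *)
Definition adapted p := seminorm p /\ C0 [set x | (p x < 1)%R].

Lemma C0_adapted C : C0 C -> exists2 p, adapted p & C = [set x | (p x < 1)%R].
Proof.
move=> CC; have [_ Cint] := evlcm_internal hX CC.
have [p hp CE] := internal_seminorm Cint (evlcm_sym hX CC).
by exists p => //; split => //; rewrite -CE.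
Qed.

Lemma seminorm_dilate p r : seminorm p -> (0 < r)%R ->
  dilate r [set x | (p x < 1)%R] = [set x | (p x < r)%R].
Proof.
move=> [_ _ pZ] r0; have rn : r != 0%R by rewrite gt_eqF.
apply/seteqP; split => x; rewrite dilateP //= pZ gtr0_norm ?invr_gt0 //.
  by rewrite mulrC ltr_pdivrMr // mul1r.
by rewrite mulrC ltr_pdivrMr // mul1r.
Qed.

Lemma C0_sball p r : adapted p -> (0 < r)%R -> C0 [set x | (p x < r)%R].
Proof.
move=> [hp Cp] r0; rewrite -seminorm_dilate //.
by apply: (evlcm_dilate hX) => //; rewrite gt_eqF.
Qed.

Lemma sball_translate p x r : translate x [set y | (p y < r)%R] = sball p x r.
Proof. by apply/seteqP; split => y; rewrite translateP. Qed.

Lemma measurable_sball p x r : adapted p -> (0 < r)%R -> F (sball p x r).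
Proof.
move=> ap r0; rewrite -sball_translate; apply: (evlcm_translate_sets hX).
by have [] := evlcm_internal hX (C0_sball ap r0).
Qed.

Lemma nbhs_sball p x r : adapted p -> (0 < r)%R -> nbhs x (sball p x r).
Proof.
move=> ap r0; rewrite -sball_translate; apply: (@nbhsT _ _ _ x).
rewrite (evlcm_nbhs hX); exists [set y | (p y < r)%R] => //.
exact: C0_sball.
Qed.

Lemma dual_adapted (l : {scalar X}) : dual_space X l ->
  exists2 p, adapted p & forall z, (`|l z| <= p z)%R.
Proof.
move=> lc; have : \forall z \near (0%R : X), (`|l z| < 1)%R.
  have /cvgrPdist_lt/(_ 1%R ltr01) := lc 0%R; rewrite linear0.
  by apply: filterS => z; rewrite sub0r normrN.
rewrite /prop_near1 (evlcm_nbhs hX) => -[C CC Cl].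
have [p ap CE] := C0_adapted CC; exists p => // z; rewrite leNgt; apply/negP => pl.
have [[p0 _ pZ] _] := ap.
have l0 : (0 < `|l z|)%R by apply: le_lt_trans pl; exact: p0.
have /Cl : C ((`|l z|)^-1 *: z)%R.
  by rewrite CE /= pZ gtr0_norm ?invr_gt0 // mulrC ltr_pdivrMr // mul1r.
by rewrite /= linearZ /= normrM gtr0_norm ?invr_gt0 // mulVf ?gt_eqF // ltxx.
Qed.

Lemma adapted_dual (l : {scalar X}) p (M : R) : adapted p ->
  (forall z, l z <= M * p z)%R -> dual_space X l.
Proof.
move=> ap lM x; have [hp _] := ap; have [p0 _ _] := hp.
apply/cvgrPdist_lt => e e0.
have M0 : (0 < `|M| + 1)%R by rewrite ltr_wpDl.
apply: filterS (nbhs_sball x ap (divr_gt0 e0 M0)) => y; rewrite /sball /=.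
rewrite ltr_pdivlMr // -linearB /= => pe.
have H z : (l z <= p z * (`|M| + 1))%R.
  apply: (le_trans (lM z)); rewrite mulrC ler_wpM2l //.
  by apply: (le_trans (ler_norm _)); rewrite lerDl.
rewrite ltr_norml; apply/andP; split.
  by rewrite ltrNl -linearN opprB; apply: le_lt_trans pe; exact: H.
apply: le_lt_trans pe; rewrite -[p (y - x)%R](seminormN _ hp) opprB; exact: H.
Qed.

End Adapted.
Arguments adapted {R X} C0 p.

Section Entropy.
Context {R : realType} {X : tvsType R} {F C0 : set (set X)} {d : nat}.
Hypothesis hX : evlcm F C0.
Variable mu : forall L : box d, probability (locType F L) R.
Implicit Types (p : X -> R) (x y z : X) (r : R) (a : \bar R).

Lemma entropy_le p x r : adapted C0 p -> (0 < r)%R ->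
  entropy C0 mu x <= limn_einf (fun n => rate d n (cramer mu n (sball p x r))).
Proof.
move=> ap r0; apply: ereal_inf_lbound; exists (sball p x r) => //.
exists [set y | (p y < r)%R]; first exact: (C0_sball hX).
exact: sball_translate.
Qed.

Lemma le_entropy x a : (forall p, adapted C0 p ->
    a <= limn_einf (fun n => rate d n (cramer mu n (sball p x 1)))) ->
  a <= entropy C0 mu x.
Proof.
move=> h; apply: le_ereal_inf_tmp => _ [_ [C CC <-] <-].
by have [p ap ->] := C0_adapted hX CC; rewrite sball_translate; exact: h.
Qed.

Lemma entropy_lt x a : entropy C0 mu x < a -> exists2 p, adapted C0 p &
  limn_einf (fun n => rate d n (cramer mu n (sball p x 1))) < a.
Proof.
move=> /ereal_inf_lt[_ [_ [C CC <-] <-]].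
by have [p ap ->] := C0_adapted hX CC; rewrite sball_translate; exists p.
Qed.

Lemma entropy_le0 x : entropy C0 mu x <= 0.
Proof.
rewrite leNgt; apply/negP => s0.
have [C CC] : exists C, C0 C.
  have : nbhs (0%R : X) setT by exact: filter_nbhsT.
  by rewrite (evlcm_nbhs hX) => -[C CC _]; exists C.
have [p ap _] := C0_adapted hX CC.
have /lt_limn_einf[m /(_ m (leqnn m))] := lt_le_trans s0 (entropy_le x ap ltr01).
rewrite ltNge rate_le0 // probability_le1 //.
by apply: measurable_measType; apply: (measurable_sball hX).
Qed.

Lemma adapted_site p : scit mu -> locally_controlled mu -> adapted C0 p ->
  exists t a : R, [/\ (0 < t)%R, (0 < a)%R & site_ge mu [set x | (p x < t)%R] a].
Proof.
move=> hmu [t [a h]] ap; have [hp Cp] := ap.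
have [t0 a0 hc] := h _ (evlcm_internal hX Cp).
exists (t [set x | (p x < 1)%R]), (a [set x | (p x < 1)%R]); split => //.
apply: cond_prob_ge_site => //.
  by have [] := evlcm_internal hX (C0_sball hX ap t0).
by move=> L L0; have := hc L L (fsubset_refl _) L0; rewrite seminorm_dilate.
Qed.

End Entropy.

Section Packed.
Context {R : realType} {X : tvsType R} {F : set (set X)} {d : nat}.
Local Notation Zd := 'rV[int]_d.
Local Notation config := (Zd -> X).
Hypothesis hF : sigma_algebra [set: X] F.
Hypothesis hd : (0 < d)%N.
Variable mu : forall L : box d, probability (locType F L) R.
Hypothesis hmu : scit mu.
Hypothesis hadi : adi mu.

(** Disjoint translates [B j] of the cube of side [n], which fill the cube of
   side [N] up to the few sites of [T], and on which the configuration is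
   decoupled from below at a cost of at most [e] per site. All the limits below
   are obtained from these properties alone. *)
Record packed (e : R) (n N : nat) (J : finType) (B : J -> {fset Zd})
    (T : {fset Zd}) : Prop := Packed {
  packed_card : (#|J| * n ^ d + #|` T|%fset = N ^ d)%N ;
  packed_small : (#|` T|%fset%:R <= e * (N ^ d)%:R)%R ;
  packed_mean : forall s : config, (mean (Lambda N) s = ((N ^ d)%:R : R)^-1 *:
    (\sum_j ((n ^ d)%:R : R) *: mean (B j) s + \sum_(z <- T) s z))%R ;
  packed_convex : forall (D : set X) (s : config), convex_set D ->
    (forall z, D (s z)) -> forall j, D (mean (B j) s) ;
  packed_event : forall (A : J -> set X) G, (forall j, F (A j)) -> F G ->
    sigma_loc F (Lambda N) [set s : config |
      (forall j, A j (mean (B j) s)) /\ (forall z, z \in T -> G (s z))] ;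
  packed_ge : forall (A : J -> set X) (q : J -> R) G (a : R), (forall j, F (A j)) ->
    (forall j, 0 <= q j)%R -> (forall j, (q j)%:E <= cramer mu n (A j)) ->
    site_ge mu G a -> (0 <= a)%R ->
    (a ^+ #|` T|%fset * \prod_j (expR (- (e * (n ^ d)%:R)) * q j))%:E <=
      mu (Lambda N) [set s : config |
        (forall j, A j (mean (B j) s)) /\ (forall z, z \in T -> G (s z))]
}.

Lemma packedP (e : R) : (0 < e)%R -> exists n0, forall n, (n0 <= n)%N ->
  (0 < n)%N /\ exists N0, forall N, (N0 <= N)%N -> (0 < N)%N /\
    exists (J : finType) (B : J -> {fset Zd}) (T : {fset Zd}), packed e n N B T.
Proof.
move=> e0; have [g [c [gc0 gm cm adiP]]] := hadi.
have [n0 hn0] := block_sizes hd e0 (fun m m0 => (gc0 m m0).1) gm cm.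
exists n0 => n /hn0[np cn [h [gh [N0 hN0]]]]; split => //.
exists N0 => N /hN0[Np small]; split => //.
set m := (N %/ h)%N in small.
have nh : (n < h)%N.
  rewrite -(ltr_nat R); apply: le_lt_trans gh; rewrite lerDl.
  exact: (gc0 n np).1.
have hmN : (h * m <= N)%N by rewrite mulnC; exact: leq_trunc_div.
pose T := @leftover d n h m N; pose B (j : 'rV['I_m]_d) := block n h j.
exists 'rV['I_m]_d, B, T.
have cardT : (#|` T|%fset + (m * n) ^ d = N ^ d)%N := card_leftover nh hmN.
have blockE j : (shift_box (corner h j) (Lambda n) : {fset Zd}) = B j.
  by rewrite /B /block -Lambda_cube.
have BN j : (B j `<=` (Lambda N : {fset Zd}))%fset.
  by rewrite Lambda_cube //; exact: (block_sub nh hmN).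
split.
- by rewrite card_mx card_ord mul1n -expnMn addnC.
- by apply: le_trans small; rewrite -cardT natrD addrK.
- exact: (mean_blocks np nh hmN).
- move=> D s cD Ds j; rewrite /mean /B card_fshift card_cube.
  have h0 : (0 < \sum_(q <- [seq (1%R : R, s z) | z <- block n h j]) q.1)%R.
    rewrite big_map /= big_const_seq count_predT iter_addr_0.
    by rewrite -[size _]/(#|` block n h j|%fset) card_fshift card_cube ltr0n expn_gt0 np.
  have := convex_comb cD _ h0; rewrite !big_map /= big_const_seq count_predT iter_addr_0.
  rewrite -[size _]/(#|` block n h j|%fset) card_fshift card_cube.
  rewrite (eq_bigr s) => [|z _]; last by rewrite scale1r.
  apply.
  by move=> q /mapP[z _ ->] /=.
- move=> A G FA FG; rewrite (_ : [set _ | _] =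
    [set s | forall j, j \in index_enum _ -> A j (mean (B j) s)] `&`
    [set s : config | forall z, z \in T -> G (s z)]); last first.
    apply/seteqP; split=> s /= [H1 H2]; split => //.
    by move=> j; apply: H1; rewrite mem_index_enum.
  apply: sigma_locI; first by apply: sigma_loc_blocks => // j _; exact: BN.
  apply: sigma_loc_sites => // z zT; rewrite Lambda_cube //.
  exact: (fsubsetP (leftover_sub _ _ _ _) _ zT).
- move=> A q G a FA q0 qA Ga a0.
  apply: le_trans (decoupling hmu adiP np nh hmN Np gh FA q0 qA Ga a0).
  rewrite lee_fin; apply: ler_wpM2l; first by rewrite exprn_ge0.
  apply: ler_prod => j _; rewrite mulr_ge0 ?expR_ge0 //=.
  by rewrite ler_wpM2r // ler_expR lerN2.
Qed.

Lemma N_large (e M : R) : (0 < e)%R ->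
  exists N0, forall N, (N0 <= N)%N -> (M <= e * (N ^ d)%:R)%R.
Proof.
move=> e0; exists (Num.truncn `|M / e|%R).+1 => N hN.
rewrite mulrC -ler_pdivrMr //; apply: (le_trans (ler_norm _)).
apply: (@le_trans _ _ N%:R%R); last by rewrite ler_nat; rewrite -{1}(expn1 N) leq_pexp2l // (leq_trans _ hN).
apply/ltW/(lt_le_trans (truncnS_gt _)); by rewrite ler_nat.
Qed.

End Packed.

(** * Mixing blocks *)

Section Mixing.
Context {R : realType} {X : tvsType R} {F C0 : set (set X)} {d : nat}.
Local Notation Zd := 'rV[int]_d.
Local Notation config := (Zd -> X).
Hypothesis hX : evlcm F C0.
Hypothesis hd : (0 < d)%N.
Variable mu : forall L : box d, probability (locType F L) R.
Hypothesis hmu : scit mu.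
Hypothesis hadi : adi mu.
Hypothesis hcl : locally_controlled mu.
Implicit Types (p : X -> R) (x y z : X).

Lemma sum_first (V : zmodType) (J : finType) (i : nat) (u v : V) : (i <= #|J|)%N ->
  (\sum_(j : J) (if (enum_rank j < i)%N then u else v) =
   u *+ i + v *+ (#|J| - i))%R.
Proof.
move=> ik; rewrite (reindex (@enum_val J predT)) /=; last first.
  by apply: onW_bij; exact: enum_val_bij.
rewrite (eq_bigr (fun r : 'I_#|J| => if (r < i)%N then u else v)); last first.
  by move=> r _; rewrite enum_valK.
rewrite -(big_mkord predT (fun r => if (r < i)%N then u else v)).
rewrite (big_cat_nat (leq0n i)) //=; congr (_ + _)%R.
  rewrite (eq_big_nat _ _ (F2 := fun=> u)); last by move=> r /andP[_ ->].
  by rewrite big_const_nat subn0 iter_addr_0.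
rewrite (eq_big_nat _ _ (F2 := fun=> v)); last first.
  by move=> r /andP[ir _]; rewrite ltnNge ir.
by rewrite big_const_nat iter_addr_0.
Qed.

(* Exponents: the bound of [packed_ge] against the bound to be proved, for [k]
   blocks of volume [nd], [i] of which are of the first kind, and [T] sites. *)
Let mix_arith (Nd nd k i T a b t e dl la : R) :
  (0 <= nd -> 0 <= k -> 0 <= T -> 0 < Nd -> 0 <= dl ->
  k * nd + T = Nd -> T <= dl * Nd -> nd * (1 + `|b|) <= dl * Nd ->
  a <= 0 -> b <= 0 -> 0 <= t <= 1 -> i <= t * k -> t * k < i + 1 ->
  dl * (`|la| + 2) <= e ->
  Nd * (t * a + (1 - t) * b - e) <=
    T * la + (- (dl * nd) * k + nd * (a * i + b * (k - i))))%R.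
Proof.
move=> nd0 k0 T0 Nd0 dl0 card small Nbig a0 b0 /andP[t0 t1] ik ki dle.
rewrite (ler0_norm b0) in Nbig.
have h1 : (- (dl * `|la|) * Nd <= T * la)%R.
  have : (- `|la| <= la)%R by rewrite lerNl -normrN ler_norm.
  have : (0 <= `|la|)%R by [].
  by set A := `|la|%R => A0 Ala; nra.
have knN : (k * nd <= Nd)%R by lra.
have h2 : (- dl * Nd <= - (dl * nd) * k)%R by nra.
have h3 : (t * a * Nd <= nd * (a * i))%R.
  have s1 : (nd * (a * (t * k)) <= nd * (a * i))%R.
    by apply: ler_wpM2l => //; apply: ler_wnM2l.
  apply: le_trans s1; rewrite (_ : nd * (a * (t * k)) = t * a * (k * nd))%R; last by ring.
  by apply: ler_wnM2l => //; rewrite mulr_ge0_le0.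
have h4 : ((1 - t) * b * Nd - dl * Nd <= nd * (b * (k - i)))%R.
  have s1 : (nd * (b * ((1 - t) * k + 1)) <= nd * (b * (k - i)))%R.
    apply: ler_wpM2l => //; apply: ler_wnM2l => //; lra.
  apply: le_trans s1.
  rewrite (_ : nd * (b * ((1 - t) * k + 1)) = (1 - t) * b * (k * nd) + nd * b)%R; last by ring.
  apply: lerD; last by nra.
  by apply: ler_wnM2l => //; rewrite mulr_ge0_le0 // subr_ge0.
have h5 : (dl * (`|la| + 2) * Nd <= e * Nd)%R by rewrite ler_wpM2r // ltW.
rewrite mulrDr; nra.
Qed.

(** The means over the blocks are prescribed to be close to [x] in a proportion
   [t] of the blocks and close to [y] in the others; the mean over the large cube
   is then close to [t x + (1 - t) y], as there are few other sites and their
   values are bounded. *)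
Lemma decoupled_balls p x y (t a b e : R) : adapted C0 p -> (0 <= t <= 1)%R ->
  (0 < e)%R ->
  (forall m, exists n, [/\ (m <= n)%N,
     a%:E < rate d n (cramer mu n (sball p x 4^-1)) &
     b%:E < rate d n (cramer mu n (sball p y 4^-1))]) ->
  exists N0, forall N, (N0 <= N)%N -> (t * a + (1 - t) * b - e)%:E <=
    rate d N (cramer mu N (sball p (t *: x + (1 - t) *: y)%R 1)).
Proof.
move=> ap t01 e0 hn; have [[p0 pD pZ] _] := ap; have [hp _] := ap.
have hF := evlcm_sigma_algebra hX.
have [tau [al [tau0 al0 hsite]]] := adapted_site hX hmu hcl ap.
pose la := ln al.
(* The proportion [dl] of sites outside of the blocks makes the three errors
   small: on the rate, on the sum over these sites, and on the proportions in
   which [x] and [y] are mixed. *)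
pose dl : R := (Num.min (e / (`|la| + 2)) (Num.min (4^-1 / tau) (8^-1 / (p x + p y + 1))))%R.
have la2 : (0 < `|la| + 2)%R by rewrite ltr_wpDl.
have pxy1 : (0 < p x + p y + 1)%R by rewrite ltr_wpDl // addr_ge0.
have dl0 : (0 < dl)%R by rewrite !lt_min !divr_gt0.
have dl1 : (dl * (`|la| + 2) <= e)%R.
  by rewrite -ler_pdivlMr // /dl ge_min lexx.
have dl2 : (dl * tau <= 4^-1)%R.
  by rewrite -ler_pdivlMr // /dl !ge_min lexx orbT.
have dl3 : (dl * (p x + p y + 1) <= 8^-1)%R.
  by rewrite -ler_pdivlMr // /dl !ge_min lexx !orbT.
have [n0 hpack] := packedP hd hmu hadi dl0.
have [n [n0n an bn]] := hn n0; have [np [N1 hN1]] := hpack n n0n.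
pose nd : R := (n ^ d)%:R.
have [N2 hN2] := N_large hd (nd * (1 + `|b|))%R dl0.
exists (maxn N1 N2) => N; rewrite geq_max => /andP[/hN1[Np [J [B [T hB]]]] /hN2 Nbig].
pose Nd : R := (N ^ d)%:R; rewrite -/Nd in Nbig.
pose k := #|J|; pose i := Num.truncn (t * k%:R)%R.
have k0 : (0 <= k%:R :> R)%R by [].
have [t0 t1] := andP t01.
have tk0 : (0 <= t * k%:R)%R by rewrite mulr_ge0.
have ik1 : (i%:R <= t * k%:R)%R by rewrite truncn_le.
have ik2 : (t * k%:R < i%:R + 1)%R by rewrite natr1; exact: truncnS_gt.
have ik : (i <= k)%N.
  by rewrite -(ler_nat R); apply: (le_trans ik1); rewrite ler_piMl.
pose first (j : J) := (enum_rank j < i)%N.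
pose A (j : J) : set X := sball p (if first j then x else y) 4^-1.
pose q (j : J) := expR (nd * (if first j then a else b))%R.
have FA j : F (A j) by apply: (measurable_sball hX).
have qA j : (q j)%:E <= cramer mu n (A j).
  rewrite /q /A /nd -card_Lambda //; case: (first j).
    by rewrite -le_rate // ltW.
  by rewrite -le_rate // ltW.
have q0 j : (0 <= q j)%R by exact: expR_ge0.
have mono z r : (0 < r)%R -> measurable (sball p z r : set (measType F)).
  by move=> r0; apply: measurable_measType; exact: (measurable_sball hX).
have a0 : (a <= 0)%R.
  rewrite -lee_fin; apply: ltW; apply: (lt_le_trans an); apply: rate_le0.
  by apply: probability_le1; exact: mono.
have b0 : (b <= 0)%R.
  rewrite -lee_fin; apply: ltW; apply: (lt_le_trans bn); apply: rate_le0.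
  by apply: probability_le1; exact: mono.
have Nd0 : (0 < Nd)%R by rewrite ltr0n expn_gt0 Np.
have nd0 : (0 < nd)%R by rewrite ltr0n expn_gt0 np.
pose G := [set z | (p z < tau)%R].
have FG : F G by have [] := hsite.
have cardE : (k%:R * nd + #|` T|%fset%:R = Nd)%R.
  by rewrite /nd /Nd -(packed_card hB) natrD natrM.
have small := packed_small hB; rewrite -/Nd in small.
rewrite le_rate // card_Lambda // -/Nd.
pose E := [set s : config |
  (forall j, A j (mean (B j) s)) /\ (forall u, u \in T -> G (s u))].
have EN : (expR (Nd * (t * a + (1 - t) * b - e)))%:E <= mu (Lambda N) E.
  apply: le_trans (packed_ge hB FA q0 qA hsite (ltW al0)); rewrite lee_fin.
  rewrite -{1}(lnK (_ : al \is Num.pos)) // -expRM_natl.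
  under eq_bigr do rewrite -expRD.
  rewrite -expR_sum -expRD ler_expR big_split /= sumr_const -(mulr_natr (- _)%R).
  rewrite -mulr_sumr (sum_first (V := R)) // -(mulr_natr a) -(mulr_natr b) natrB //.
  exact: (mix_arith (ltW nd0) k0 (ler0n R _) Nd0 (ltW dl0) cardE small Nbig a0 b0
    t01 ik1 ik2 dl1).
apply: (le_trans EN).
rewrite cramerE; apply: le_measure; rewrite ?inE.
- exact: (packed_event hB).
- by apply: sigma_loc_mean => //; exact: (measurable_sball hX).
move=> s /= [sA sT]; rewrite /sball /= (packed_mean hB) -/nd -/Nd.
pose w : R := (nd / Nd)%R.
have w0 : (0 <= w)%R by rewrite divr_ge0 // ltW.
pose c j := if first j then x else y.
have -> : (Nd^-1 *: (\sum_j nd *: mean (B j) s + \sum_(z <- T) s z) -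
    (t *: x + (1 - t) *: y) =
    \sum_j w *: (mean (B j) s - c j) + \sum_(z <- T) Nd^-1 *: s z +
    ((w * i%:R - t) *: x + (w * (k - i)%:R - (1 - t)) *: y))%R.
  have -> : (\sum_j w *: (mean (B j) s - c j) =
      Nd^-1 *: (\sum_j nd *: mean (B j) s) -
      ((w * i%:R) *: x + (w * (k - i)%:R) *: y))%R.
    rewrite -!(scalerA w) !scaler_nat -scalerDr -(sum_first (V := X)) //.
    rewrite !scaler_sumr -sumrB; apply: eq_bigr => j _.
    by rewrite scalerBr (scalerA Nd^-1 nd) [(Nd^-1 * nd)%R]mulrC.
  rewrite -(scaler_sumr Nd^-1) !(scalerBl (w * _)%R) [in RHS](addrACA ((w * i%:R) *: x)%R).
  rewrite -opprD scalerDr; move: ((w * i%:R) *: x + _)%R (t *: x + _)%R => Q Z.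
  by rewrite [LHS]addrAC [in RHS]addrAC addrA subrK.
(* Each of the three terms has seminorm at most 1/4. *)
have dNd : (w * k%:R + #|` T|%fset%:R / Nd = 1)%R.
  by rewrite /w mulrAC -mulrDl [(nd * _)%R]mulrC cardE divff ?gt_eqF.
have TN : (#|` T|%fset%:R / Nd <= dl)%R by rewrite ler_pdivrMr.
have TN0 : (0 <= #|` T|%fset%:R / Nd)%R by rewrite divr_ge0 // ltW.
have wdl : (w <= dl)%R.
  rewrite ler_pdivrMr //; apply: le_trans Nbig; rewrite ler_pMr // lerDl //.
have h1 : (p (\sum_j w *: (mean (B j) s - c j)) <= 4^-1)%R.
  apply: (le_trans (seminorm_sum _ _ hp)).
  apply: (@le_trans _ _ (\sum_(j : J) w * 4^-1)%R).
    apply: ler_sum => j _; rewrite pZ ger0_norm // ler_wpM2l //; apply: ltW.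
    exact: sA.
  rewrite sumr_const -(mulr_natr (w * _)) -/k mulrAC ler_piMl //; lra.
have h2 : (p (\sum_(z <- T) Nd^-1 *: s z) <= 4^-1)%R.
  apply: (le_trans (seminorm_sum _ _ hp)).
  apply: (@le_trans _ _ (\sum_(u <- T) Nd^-1 * tau)%R).
    rewrite big_seq [leRHS]big_seq; apply: ler_sum => u uT.
    rewrite pZ ger0_norm ?invr_ge0 ?(ltW Nd0) //.
    by rewrite ler_wpM2l ?invr_ge0 ?(ltW Nd0) // ltW //; exact: sT.
  rewrite big_const_seq count_predT iter_addr_0 -(mulr_natr (_ * tau)).
  rewrite mulrAC mulrC -[size _]/(#|` T|%fset) [(_ * _%:R)%R]mulrC mulrC.
  by apply: le_trans dl2; rewrite ler_wpM2r // ltW.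
have third (u v : R) z : (`|u| <= v)%R -> (p (u *: z) <= v * p z)%R.
  by move=> uv; rewrite pZ ler_wpM2r.
have h3 : (p ((w * i%:R - t) *: x + (w * (k - i)%:R - (1 - t)) *: y) <= 4^-1)%R.
  apply: (le_trans (pD _ _)).
  have e1 : (`|w * i%:R - t| <= 2 * dl)%R.
    rewrite ler_norml; nra.
  have e2 : (`|w * (k - i)%:R - (1 - t)| <= 2 * dl)%R.
    rewrite natrB // ler_norml; nra.
  have := third _ _ x e1; have := third _ _ y e2.
  have := p0 x; have := p0 y; nra.
apply: (le_lt_trans (pD _ _)).
have := pD (\sum_j w *: (mean (B j) s - c j))%R (\sum_(z <- T) Nd^-1 *: s z)%R.
lra.
Qed.

End Mixing.

(** * Extended reals and integrals *)

Section ExtendedReals.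
Context {R : realType}.
Implicit Types (L M : \bar R).

Lemma lee_real L M : (forall a : R, a%:E < L -> a%:E <= M) -> L <= M.
Proof.
move=> h; rewrite leNgt; apply/negP; move: L M h => [l| |] [m| |] h // ml.
- move: ml; rewrite lte_fin => ml; have := h ((m + l) / 2)%R.
  by rewrite lte_fin lee_fin => /(_ ltac:(lra)); lra.
- by have := h (l - 1)%R; rewrite lte_fin => /(_ ltac:(lra)).
- by have := h (m + 1)%R (ltry _); rewrite lee_fin; lra.
- by have := h 0%R (ltry _).
Qed.

Lemma gee_real L M : (forall a : R, L < a%:E -> M <= a%:E) -> M <= L.
Proof.
move=> h; rewrite -leeN2; apply: lee_real => a; rewrite lteNr -EFinN => /h.
by rewrite leeNr.
Qed.

Lemma lee_epsilon (a : R) L : (forall e, (0 < e)%R -> (a - e)%:E <= L) -> a%:E <= L.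
Proof.
move=> h; apply: lee_real => b; rewrite lte_fin => ba.
by have := h (a - b)%R; rewrite subKr subr_gt0; apply.
Qed.

Lemma gee_epsilon (a : R) L : (forall e, (0 < e)%R -> L <= (a + e)%:E) -> L <= a%:E.
Proof.
move=> h; apply: gee_real => b; rewrite lte_fin => ab.
by have := h (b - a)%R; rewrite subr_gt0 addrC subrK; apply.
Qed.

End ExtendedReals.

Section Integrals.
Context d (T : measurableType d) (R : realType) (m : {measure set T -> \bar R}).
Implicit Types (f : T -> \bar R) (A B : set T).

Lemma ge0_integral_setU_le A B f : measurable A -> measurable B ->
  measurable_fun setT f -> (forall x, 0 <= f x) ->
  \int[m]_(x in A `|` B) f x <= \int[m]_(x in A) f x + \int[m]_(x in B) f x.
Proof.
move=> mA mB mf f0; have mBA : measurable (B `\` A) by exact: measurableD.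
have -> : A `|` B = A `|` (B `\` A).
  by apply/seteqP; split => x /=; have [] := pselect (A x); tauto.
rewrite ge0_integral_setU //.
- rewrite leeD2l // ge0_subset_integral //; first exact: measurable_funTS.
- exact: measurable_funTS.
- by apply/disj_set2P; apply/seteqP; split => x //= [Ax [_ /(_ Ax)]].
Qed.

Lemma ge0_integral_cover (I : Type) (s : seq I) (V : I -> set T) f :
  (forall i, measurable (V i)) -> measurable_fun setT f -> (forall x, 0 <= f x) ->
  \int[m]_(x in \big[setU/set0]_(i <- s) V i) f x <=
    \sum_(i <- s) \int[m]_(x in V i) f x.
Proof.
move=> mV mf f0; elim: s => [|i s IH]; first by rewrite !big_nil integral_set0.
rewrite !big_cons; apply: (le_trans (ge0_integral_setU_le _ _ mf f0)) => //.
  exact: bigsetU_measurable.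
by rewrite leeD2l.
Qed.

Lemma integral_le_cst A f (c : R) : measurable A -> measurable_fun setT f ->
  (forall x, 0 <= f x) -> (forall x, A x -> f x <= c%:E) ->
  \int[m]_(x in A) f x <= c%:E * m A.
Proof.
move=> mA mf f0 fc; rewrite -integral_cst //.
have [->|/set0P[x Ax]] := eqVneq A set0; first by rewrite !integral_set0.
have c0 : 0 <= c%:E by apply: le_trans (fc x Ax).
apply: ge0_le_integral => //; exact: measurable_funTS.
Qed.

Lemma cst_le_integral A f (c : R) : measurable A -> measurable_fun setT f ->
  (forall x, 0 <= f x) -> (0 <= c)%R -> (forall x, A x -> c%:E <= f x) ->
  c%:E * m A <= \int[m]_(x in A) f x.
Proof.
move=> mA mf f0 c0 fc; rewrite -integral_cst //.
apply: ge0_le_integral => //; exact: measurable_funTS.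
Qed.

Lemma disjoint_sum_le_integral (I : finType) (E : I -> set T) (c : I -> R) f :
  (forall i, measurable (E i)) -> trivIset setT E -> measurable_fun setT f ->
  (forall x, 0 <= f x) -> (forall i, 0 <= c i)%R ->
  (forall i x, E i x -> (c i)%:E <= f x) ->
  \sum_i (c i)%:E * m (E i) <= \int[m]_x f x.
Proof.
move=> mE tE mf f0 c0 cf.
apply: (@le_trans _ _ (\sum_i \int[m]_(x in E i) f x)).
  by apply: lee_sum => i _; apply: cst_le_integral => // x; exact: cf.
have tI : trivIset [set` index_enum I] E by apply: sub_trivIset tE.
rewrite -(ge0_integral_bigsetU m mE (index_enum_uniq I) tI) //.
  apply: ge0_subset_integral => //; exact: bigsetU_measurable.
exact: measurable_funTS.
Qed.

End Integrals.

(** * Concavity of the entropy and upper bound *)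

(** Any point turns the space into a pointed one, where [compact_cover] applies. *)
Lemma compact_cover_at (T : topologicalType) (x0 : T) (K : set T) :
  compact K -> cover_compact K.
Proof.
pose p := isPointed.Build T x0.
pose T' : ptopologicalType := HB.pack (Topological.sort T) p.
by move=> cK; have : @cover_compact T' K by rewrite -(@compact_cover T').
Qed.

Section UpperBound.
Context {R : realType} {X : tvsType R} {F C0 : set (set X)} {d : nat}.
Local Notation Zd := 'rV[int]_d.
Local Notation config := (Zd -> X).
Hypothesis hX : evlcm F C0.
Hypothesis hd : (0 < d)%N.
Variable mu : forall L : box d, probability (locType F L) R.
Hypothesis hmu : scit mu.
Hypothesis hadi : adi mu.
Hypothesis hcl : locally_controlled mu.
Implicit Types (p : X -> R) (x y : X).

(** A weak form of the existence of the limit: the upper rate of a ball is at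
   most the lower rate of a larger one. All the blocks are taken close to [x]. *)
Lemma limn_esup_ball p x : adapted C0 p ->
  limn_esup (fun n => rate d n (cramer mu n (sball p x 4^-1))) <=
  limn_einf (fun n => rate d n (cramer mu n (sball p x 1))).
Proof.
move=> ap; apply: lee_real => a alt; apply: lee_epsilon => e e0.
have t01 : (0 <= (1 : R) <= 1)%R by rewrite ler01 lexx.
have [|N0 hN] := decoupled_balls hX hd hmu hadi hcl (x := x) (y := x) (a := a) (b := a) ap t01 e0.
  by move=> m; have [n mn an] := lt_limn_esup m alt; exists n.
apply: (@le_limn_einf _ _ _ N0) => N /hN.
by rewrite subrr scale0r scale1r addr0 mul0r mul1r addr0.
Qed.

Lemma entropy_concave x y (t a b : R) : (0 <= t <= 1)%R ->
  a%:E < entropy C0 mu x -> b%:E < entropy C0 mu y ->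
  (t * a + (1 - t) * b)%:E <= entropy C0 mu (t *: x + (1 - t) *: y)%R.
Proof.
move=> t01 ax by_; apply: (le_entropy hX) => p ap; apply: lee_epsilon => e e0.
have r0 : (0 < 4^-1 :> R)%R by [].
have [m1 h1] := lt_limn_einf (lt_le_trans ax (entropy_le hX mu x ap r0)).
have [m2 h2] := lt_limn_einf (lt_le_trans by_ (entropy_le hX mu y ap r0)).
have [|N0 hN] := decoupled_balls hX hd hmu hadi hcl (x := x) (y := y) (a := a) (b := b) ap t01 e0.
  move=> m; exists (maxn m (maxn m1 m2)); split; first exact: leq_maxl.
    by apply: h1; rewrite leq_max leq_max leqnn !orbT.
  by apply: h2; rewrite leq_max leq_max leqnn !orbT.
exact: le_limn_einf hN.
Qed.

Section Carried.
Variable D : set X.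
Hypothesis hD : convex_set D.
Hypothesis hmuD : carried mu [set s : config | forall z, D (s z)].

Lemma mean_convex n (s : config) (G : set X) : convex_set G ->
  (forall z, z \in (Lambda n : {fset Zd}) -> G (s z)) -> G (mean (Lambda n) s).
Proof.
move=> cG Gs; have h0 : (0 < \sum_(q <- [seq (1%R : R, s z) | z <- (Lambda n : {fset Zd})]) q.1)%R.
  rewrite big_map /= big_const_seq count_predT iter_addr_0.
  exact: card_Lambda_gt0.
have := convex_comb cG _ h0; rewrite !big_map /= big_const_seq count_predT iter_addr_0.
rewrite (eq_bigr s) => [|z _]; last by rewrite scale1r.
by apply=> q /mapP[z zL ->] /=; split => //; exact: Gs.
Qed.

(** As [D] is convex, the mean of a configuration with values in [D] is in [D]. *)
Lemma cramer_carried n A B : F A -> F B -> A `&` D = B `&` D ->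
  cramer mu n A = cramer mu n B.
Proof.
move=> FA FB AB; rewrite !cramerE; apply: hmuD.
- exact: sigma_loc_mean.
- exact: sigma_loc_mean.
apply/seteqP; split => s /= [As Ds]; split => //.
  have : (A `&` D) (mean (Lambda n) s) by split => //; apply: mean_convex.
  by rewrite AB => -[].
have : (B `&` D) (mean (Lambda n) s) by split => //; apply: mean_convex.
by rewrite -AB => -[].
Qed.

(** The upper bound for Laplace transforms over a set with relatively compact
   trace on [D]: it is covered by finitely many small balls, on each of which
   the upper rate is bounded by the lower rate of a slightly larger ball. For
   [l = 0] this is the upper bound for the measures of the sets. *)
Lemma laplace_upper_bound (K : set X) (l : X -> R) : F K -> rel_compact (K `&` D) ->
  measurable_fun setT (l : measType F -> R) ->
  (exists2 p, adapted C0 p & forall x y, (`|l x - l y| <= p (x - y))%R) ->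
  limn_esup (fun n => rate d n (\int[cramer mu n]_(x in K)
      (expR (#|` (@Lambda d n : {fset Zd})|%fset%:R * l (x : X)))%:E)) <=
  ereal_sup [set (l x)%:E + entropy C0 mu x | x in closure (K `&` D)].
Proof.
move=> FK cK ml [pl apl lpl]; set S := ereal_sup _.
apply: gee_real => b Sb; apply: gee_epsilon => e e0; rewrite (splitr e) addrA.
set ep := (e / 2)%R; have ep0 : (0 < ep)%R by rewrite divr_gt0.
pose Kc := closure (K `&` D).
pose rad : R := 4^-1%R.
have rad0 : (0 < rad)%R by rewrite invr_gt0.
have ball y : exists p, adapted C0 p /\ (Kc y ->
    limn_esup (fun n => rate d n (cramer mu n (sball p y rad))) < (b - l y)%:E).
  have [Ky|nKy] := pselect (Kc y); last by exists pl; split.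
  have : entropy C0 mu y < (b - l y)%:E.
    rewrite EFinB lteBrDl //; apply: le_lt_trans Sb.
    by apply: ereal_sup_ubound; exists y.
  move=> /(entropy_lt hX)[p ap plt]; exists p; split => // _.
  exact: le_lt_trans (limn_esup_ball y ap) plt.
have [P hP] := choice ball.
pose V y := sball (P y) y rad `&` sball pl y ep.
have nV y : nbhs y (V y).
  by apply: filterI; apply: (nbhs_sball hX) => //; exact: (hP y).1.
have FV y : F (V y).
  rewrite -(measTypeE (evlcm_sigma_algebra hX)).
  apply: (@measurableI _ (measType F)); apply: measurable_measType.
    by apply: (measurable_sball hX) => //; exact: (hP y).1.
  exact: (measurable_sball hX).
have : finite_subset_cover Kc (fun y => interior (V y)) Kc.
  apply: (compact_cover_at 0%R cK); first by move=> y _; exact: open_interior.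
  by move=> y Ky; exists y => //; exact: nV.
move=> [Y YK cov].
(* One rank for all the balls of the finite cover. *)
have ev (s : seq X) : (forall y, y \in s -> Kc y) -> exists N0, forall N,
    (N0 <= N)%N -> forall y, y \in s ->
    rate d N (cramer mu N (sball (P y) y rad)) < (b - l y)%:E.
  elim: s => [|y s IH] h; first by exists 0%N.
  have [|N1 h1] := IH; first by move=> z zs; apply: h; rewrite inE zs orbT.
  have [N2 h2] := limn_esup_lt ((hP y).2 (h _ (mem_head _ _))).
  exists (maxn N1 N2) => N; rewrite geq_max => /andP[n1 n2] z /[!inE] /orP[/eqP ->|zs].
    exact: h2.
  exact: h1.
have [N0 hN0] : exists N0, forall N, (N0 <= N)%N -> forall y, y \in Y ->
    rate d N (cramer mu N (sball (P y) y rad)) < (b - l y)%:E.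
  by apply: ev => y /YK; rewrite inE.
have [N1 hN1] := N_large hd (ln (size Y).+1%:R)%R ep0.
(* [N1] makes the number of balls negligible at the exponential scale. *)
apply: (@limn_esup_le _ _ _ (maxn (maxn N0 N1) 1)) => N.
rewrite !geq_max => /andP[/andP[/hN0 small /hN1 large] Np].
set Nd : R := (#|` _|%fset%:R)%R.
have NE : Nd = (N ^ d)%:R by rewrite /Nd card_Lambda.
pose f (x : measType F) := (expR (Nd * l x))%:E.
have mf : measurable_fun setT f.
  apply/measurable_EFinP; apply: measurableT_comp => //.
  exact: measurable_funM.
have f0 x : 0 <= f x by rewrite lee_fin expR_ge0.
have mV y : measurable (V y : set (measType F)) by exact: measurable_measType.
have mK : measurable (K : set (measType F)) by exact: measurable_measType.
pose U := \big[setU/set0]_(y <- Y) (V y : set (measType F)).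
have mU : measurable U by exact: bigsetU_measurable.
rewrite rate_le; last by apply: integral_ge0 => x _; exact: f0.
(* The cover misses only points of [K] outside of [D]. *)
have KU0 : cramer mu N (K `\` U) = 0.
  rewrite -(measure0 (cramer mu N)); apply: cramer_carried.
  - rewrite -(measTypeE (evlcm_sigma_algebra hX)); exact: measurableD.
  - rewrite -(measTypeE (evlcm_sigma_algebra hX)); exact: measurable0.
  apply/seteqP; split => x /= [] //; move=> [Kx nUx] Dx; exfalso; apply: nUx.
  have [y Yy /interior_subset Vy] := cov x (subset_closure (conj Kx Dx)).
  by rewrite /U -bigcup_seq; exists y.
have -> : \int[cramer mu N]_(x in K) f x = \int[cramer mu N]_(x in K `&` U) f x.
  rewrite (ge0_negligible_integral _ _ _ _ KU0) //.
  - by rewrite setDD.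
  - exact: measurableD.
  - exact: measurable_funTS.
apply: (@le_trans _ _ (\int[cramer mu N]_(x in U) f x)).
  apply: ge0_subset_integral => //; [exact: measurableI|exact: measurable_funTS].
apply: (le_trans (ge0_integral_cover _ _ mV mf f0)).
have term y : y \in Y -> \int[cramer mu N]_(x in V y) f x <= (expR (Nd * (b + ep)))%:E.
  move=> yY; apply: (le_trans (@integral_le_cst _ _ _ _ _ _ (expR (Nd * (l y + ep))) _ mf f0 _)) => //.
    move=> x [_ xy]; rewrite lee_fin ler_expR ler_wpM2l // /Nd //.
    by have := lpl x y; rewrite ler_norml => /andP[_]; move: xy; rewrite /sball /=; lra.
  have := small y yY; rewrite rate_lt // -/Nd => h.
  apply: (@le_trans _ _ ((expR (Nd * (l y + ep)))%:E * (expR (Nd * (b - l y)))%:E)).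
    rewrite lee_wpmul2l ?lee_fin ?expR_ge0 //; apply: ltW; apply: le_lt_trans h.
    apply: le_measure; rewrite ?inE //; last by move=> x [].
    by apply: measurable_measType; apply: (measurable_sball hX) => //; exact: (hP y).1.
  rewrite -EFinM -expRD lee_fin ler_expR; lra.
apply: (@le_trans _ _ (\sum_(y <- Y) (expR (Nd * (b + ep)))%:E)).
  by rewrite big_seq [leRHS]big_seq; apply: lee_sum.
rewrite sumEFin lee_fin big_const_seq count_predT iter_addr_0 -[in leLHS]mulr_natl.
rewrite [(Nd * (b + ep + ep))%R]mulrDr expRD mulrC ler_wpM2l ?expR_ge0 //.
apply: (@le_trans _ _ (size Y).+1%:R); first by rewrite ler_nat.
rewrite -[leLHS]lnK ?posrE // ler_expR mulrC NE.
by rewrite -/ep.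
Qed.

End Carried.
End UpperBound.

(** * Simple minorants *)

Section SimpleMinorants.
Import HBNNSimple.
Context d (T : measurableType d) (R : realType).
Implicit Types (f : T -> \bar R) (D : set T).

(** The level sets, for positive levels, of a simple function below [f] on [D]. *)
Lemma simple_minorant (m : {measure set T -> \bar R}) D f (a : R) :
  (forall x, 0 <= f x) -> a%:E < \int[m]_(x in D) f x ->
  exists (I : finType) (A : I -> set T) (v : I -> R),
    [/\ forall i, measurable (A i), trivIset setT A, forall i, (0 < v i)%R,
        forall i x, A i x -> D x /\ (v i)%:E <= f x &
        a%:E < \sum_i (v i)%:E * m (A i)].
Proof.
move=> f0; rewrite ge0_integralE // => /ereal_sup_gt[_ [h hf <-]].
rewrite sintegralE fsbig_finite //=.
set Y := fset_set _ => ah.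
pose Y' := [fset x in Y | (0 < x)%R]%fset.
exists Y', (fun i => h @^-1` [set val i]), (fun i => val i); split.
- by move=> i; exact: measurable_sfunP.
- by move=> i j _ _ [x [/= xi xj]]; apply: val_inj; exact: (etrans (esym xi) xj).
- by move=> i; have := valP i; rewrite !inE => /andP[].
- move=> i x /= xi; have i0 : (0 < val i)%R by have := valP i; rewrite !inE => /andP[].
  have := hf x; rewrite xi patchE; case: ifPn => [/set_mem //|_].
  by rewrite lee_fin leNgt i0.
apply: (lt_le_trans ah); rewrite -(big_seq_fsetE _ Y' predT (fun x : R => x%:E * m (h @^-1` [set x]))) /=.
rewrite /Y' -big_fset_condE [leRHS]big_mkcond /=.
apply: lee_sum => x _; case: ifPn => // x0.
have [->|hx] := eqVneq (h @^-1` [set x]) set0; first by rewrite measure0 mule0.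
have /set0P[y /= hy] := hx; have : (0 <= h y)%R by [].
by rewrite hy le_eqVlt (negbTE x0) orbF => /eqP <-; rewrite mul0e.
Qed.

(** The integral of a simple minorant over the complement of [K] is at most a
   constant times the probability of this complement. This includes infinite
   integrals, for which dominated convergence would not apply. *)
Lemma integral_tight (P : probability T R) f (a : R) : measurable_fun setT f ->
  (forall x, 0 <= f x) -> a%:E < \int[P]_x f x ->
  exists2 e, (0 < e)%R & forall K, measurable K -> (1 - e)%:E <= P K ->
    a%:E < \int[P]_(x in K) f x.
Proof.
move=> mf f0 /(simple_minorant f0)[I [A [v [mA tA v0 Af aA]]]].
pose q i := fine (P (A i)); pose S := (\sum_i v i * q i)%R.
have qE i : P (A i) = (q i)%:E by rewrite fineK // fin_num_measure.
have {}aA : (a < S)%R.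
  rewrite -lte_fin; apply: (lt_le_trans aA); rewrite -sumEFin.
  by apply: lee_sum => i _; rewrite EFinM -qE.
pose W := (\sum_i v i + 1)%R.
have W0 : (0 < W)%R by rewrite ltr_wpDl // sumr_ge0 // => i _; exact: ltW.
exists ((S - a) / (2 * W))%R; first by rewrite divr_gt0 ?mulr_gt0 ?subr_gt0.
set e := ((S - a) / _)%R => K mK eK.
have Kq i : (q i - e)%:E <= P (A i `&` K).
  have : (1 - e)%:E <= P K := eK.
  have -> : P K = P (K `&` A i) + P (K `\` A i) by rewrite addeC (measureDI _ mK (mA i)).
  have : P (K `\` A i) <= (1 - q i)%:E.
    rewrite EFinB -qE -probability_setC //; apply: le_measure; rewrite ?inE //.
      exact: measurableD.
    exact: measurableC.
  rewrite setIC -(@fineK _ (P (K `\` A i))) ?fin_num_measure //; last exact: measurableD.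
  rewrite -(@fineK _ (P (A i `&` K))) ?fin_num_measure //; last exact: measurableI.
  rewrite -EFinD !lee_fin; lra.
apply: (@lt_le_trans _ _ (\sum_i (v i)%:E * P (A i `&` K))).
  apply: (@lt_le_trans _ _ (\sum_i (v i)%:E * (q i - e)%:E)).
    under eq_bigr do rewrite -EFinM; rewrite sumEFin lte_fin.
    under eq_bigr do rewrite mulrBr.
    rewrite sumrB -mulr_suml -/S.
    have : ((\sum_i v i) * e <= W * e)%R.
      by rewrite ler_wpM2r ?lerDl // ltW // divr_gt0 ?mulr_gt0 ?subr_gt0.
    have -> : (W * e = (S - a) / 2)%R by rewrite /e; field; rewrite gt_eqF.
    lra.
  by apply: lee_sum => i _; rewrite lee_wpmul2l // lee_fin ltW.
rewrite integral_mkcond; apply: disjoint_sum_le_integral => //.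
- by move=> i; exact: measurableI.
- by move=> i j _ _ [x [[Ai _] [Aj _]]]; apply: tA => //; exists x.
- by apply/(measurable_restrictT _ mK); exact: measurable_funTS.
- by move=> x; apply: erestrict_ge0.
- by move=> i; exact: ltW.
- by move=> i x [Ai Kx]; rewrite patchE mem_set //; case: (Af i x Ai).
Qed.

End SimpleMinorants.

(** * Lower bound for Laplace transforms *)

Section LaplaceLower.
Context {R : realType} {X : tvsType R} {F C0 : set (set X)} {d : nat}.
Local Notation Zd := 'rV[int]_d.
Local Notation config := (Zd -> X).
Hypothesis hX : evlcm F C0.
Hypothesis hd : (0 < d)%N.
Variable mu : forall L : box d, probability (locType F L) R.
Hypothesis hmu : scit mu.
Hypothesis hadi : adi mu.
Variable D : set X.
Hypothesis hD : convex_set D.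
Hypothesis hmuD : carried mu [set s : config | forall z, D (s z)].
Implicit Types (K G : set X) (l : {scalar X}).

Definition laplace K (l : X -> R) (n : nat) : \bar R := \int[cramer mu n]_(x in K)
  (expR (#|` (@Lambda d n : {fset Zd})|%fset%:R * l (x : X)))%:E.

Lemma measurable_laplace (l : X -> R) (c : R) :
  measurable_fun setT (l : measType F -> R) ->
  measurable_fun setT (fun x : measType F => (expR (c * l x))%:E).
Proof.
move=> ml; apply/measurable_EFinP; apply: measurableT_comp => //.
exact: measurable_funM.
Qed.

Lemma laplace_ge0 K (l : X -> R) n : 0 <= laplace K l n.
Proof. by apply: integral_ge0 => x _; rewrite lee_fin expR_ge0. Qed.

(* The mean over the large cube is a barycentre of the means over the blocks and
   of the values at the remaining sites. *)
Let mean_packed (e : R) n N (J : finType) (B : J -> {fset Zd}) (T : {fset Zd})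
    (K : set X) (s : config) : packed mu e n N B T -> (0 < N)%N ->
  convex_set (K `&` D) -> (forall z, D (s z)) ->
  (forall j, K (mean (B j) s)) -> (forall z, z \in T -> K (s z)) ->
  K (mean (Lambda N) s).
Proof.
move=> hB N0 cK Ds Km Ks.
pose L := [seq ((n ^ d)%:R : R, mean (B j) s) | j <- index_enum J] ++
  [seq (1%R : R, s z) | z <- T].
have sumE : (\sum_(q <- L) q.1 = (N ^ d)%:R)%R.
  rewrite big_cat !big_map /= sumr_const big_const_seq count_predT iter_addr_0.
  by rewrite -(packed_card hB) natrD natrM mulr_natl.
have h0 : (0 < \sum_(q <- L) q.1)%R by rewrite sumE ltr0n expn_gt0 N0.
have := convex_comb cK _ h0; rewrite sumE (packed_mean hB) big_cat !big_map /=.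
rewrite (eq_bigr s) => [|z _]; last by rewrite scale1r.
move=> h; apply: (proj1 (h _)) => q; rewrite mem_cat => /orP[] /mapP[z zT ->] /=.
  by split=> //; split=> //; exact: (packed_convex hB).
by split=> //; split=> //; exact: Ks.
Qed.

Let laplace_arith (Nd nd k T a e dl la tau : R) :
  (0 <= nd -> 0 <= k -> 0 <= T -> 0 < Nd -> 0 <= dl -> 0 <= tau ->
  k * nd + T = Nd -> T <= dl * Nd -> dl * (`|a| + `|la| + tau + 1) <= e ->
  Nd * (a - e) <= - (T * tau) + (T * la + k * (- (dl * nd) + nd * a)))%R.
Proof.
move=> nd0 k0 T0 Nd0 dl0 tau0 card small dle.
have h1 (u : R) : (- (dl * `|u|) * Nd <= T * u)%R.
  have : (- `|u| <= u)%R by rewrite lerNl -normrN ler_norm.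
  have : (0 <= `|u|)%R by [].
  by set A := `|u|%R => A0 Ala; nra.
have l1 := h1 la; have l2 := h1 (- a)%R; rewrite normrN in l2.
have l3 := h1 (- tau)%R; rewrite normrN (ger0_norm tau0) in l3.
have l4 : (dl * (k * nd) <= dl * Nd)%R by apply: ler_wpM2l => //; lra.
have l5 : (dl * (`|a| + `|la| + tau + 1) * Nd <= e * Nd)%R by rewrite ler_wpM2r // ltW.
have -> : (k * (- (dl * nd) + nd * a) = - (dl * (k * nd)) + (k * nd) * a)%R by ring.
have knE : (k * nd = Nd - T)%R by lra.
rewrite knE in l4 *; lra.
Qed.

(** Approximate supermultiplicativity of Laplace transforms. On the event that
   the means over the blocks lie in prescribed level sets of a simple minorant
   of the exponential, the mean over the large cube belongs to [K] by convexity
   and its exponential is bounded below; these events are disjoint, and summing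
   over all of them the decoupling bound for their probabilities gives a power
   of the integral of the minorant. *)
Lemma laplace_lower_bound l (tau al a e : R) : dual_space X l ->
  (0 <= tau)%R -> (0 < al)%R -> (0 < e)%R ->
  exists n0, forall n, (n0 <= n)%N -> (0 < n)%N /\
    forall K G, F K -> convex_set (K `&` D) -> site_ge mu G al -> G `<=` K ->
      (forall z, G z -> `|l z| <= tau)%R -> a%:E < rate d n (laplace K l n) ->
      exists N0, forall N, (N0 <= N)%N -> (a - e)%:E <= rate d N (laplace K l N).
Proof.
move=> ldual tau0 al0 e0; have ml := evlcm_measurable_form hX ldual.
pose la := ln al; pose w := (`|a| + `|la| + tau + 1)%R.
have w0 : (0 < w)%R by rewrite ltr_wpDl // !addr_ge0.
pose dl := (e / w)%R; have dl0 : (0 < dl)%R by rewrite divr_gt0.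
have dlE : (dl * w <= e)%R by rewrite /dl mulfVK ?gt_eqF.
have [n0 hpack] := packedP hd hmu hadi dl0.
exists n0 => n /hpack[np [N0 hN0]]; split => // K G FK cKD hG GK Gl.
pose nd : R := (n ^ d)%:R.
rewrite lt_rate ?laplace_ge0 // card_Lambda // -/nd {1}/laplace card_Lambda // -/nd.
have f0 c (x : measType F) : 0 <= (expR (c * l x))%:E by rewrite lee_fin expR_ge0.
move=> /(simple_minorant (f0 nd))[I [A [v [mA tA v0 Af aA]]]].
have FA i : F (A i) by rewrite -(measTypeE (evlcm_sigma_algebra hX)); exact: mA.
pose q i := fine (cramer mu n (A i)).
have qE i : (q i)%:E = cramer mu n (A i) by rewrite fineK // fin_num_measure.
have q0 i : (0 <= q i)%R by rewrite -lee_fin qE.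
have {}aA : (expR (nd * a) <= \sum_i v i * q i)%R.
  rewrite -lee_fin; apply/ltW; apply: (lt_le_trans aA); rewrite -sumEFin.
  by apply: lee_sum => i _; rewrite EFinM qE.
exists N0 => N /hN0[Np [J [B [T hB]]]].
pose Nd : R := (N ^ d)%:R.
have Nd0 : (0 < Nd)%R by rewrite ltr0n expn_gt0 Np.
rewrite le_rate ?laplace_ge0 // card_Lambda // -/Nd /laplace card_Lambda // -/Nd.
have FG : F G by have [] := hG.
pose E (f : {ffun J -> I}) := [set s : config |
  (forall j, A (f j) (mean (B j) s)) /\ (forall u, u \in T -> G (s u))].
have FE f : sigma_loc F (Lambda N) (E f) by exact: (packed_event hB (fun j => FA (f j)) FG).
pose T' : R := (#|` T|%fset%:R)%R.
pose c (f : {ffun J -> I}) := (expR (- (T' * tau)) * \prod_j v (f j))%R.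
have c0 f : (0 <= c f)%R.
  by rewrite mulr_ge0 ?expR_ge0 // prodr_ge0 // => j _; exact: ltW.
pose Phi : measType F -> \bar R := (fun x : measType F => (expR (Nd * l x))%:E) \_ K.
have mK : measurable (K : set (measType F)) by exact: measurable_measType.
have mPhi : measurable_fun setT Phi.
  apply/(measurable_restrictT _ mK); apply: measurable_funTS.
  exact: measurable_laplace.
have Phi0 x : 0 <= Phi x by apply: erestrict_ge0 => y _; exact: f0.
pose E' f := E f `&` [set s : config | (c f)%:E <= Phi (mean (Lambda N) s)].
have key f s : E f s -> (forall z, D (s z)) -> (c f)%:E <= Phi (mean (Lambda N) s).
  move=> [sA sG] Ds.
  have Km : K (mean (Lambda N) s).
    apply: (mean_packed hB) => // [j|z zT]; last by apply: GK; exact: sG.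
    by have [] := Af _ _ (sA j).
  rewrite /Phi patchE mem_set // lee_fin.
  have -> : (Nd * l (mean (Lambda N) s) =
      \sum_j nd * l (mean (B j) s) + \sum_(z <- T) l (s z))%R.
    rewrite (packed_mean hB) -/nd -/Nd scalarZ mulrA divff ?gt_eqF // mul1r.
    rewrite linearD !raddf_sum /=; congr (_ + _)%R.
    by apply: eq_bigr => j _; rewrite scalarZ.
  rewrite addrC expRD /c; apply: ler_pM; rewrite ?expR_ge0 //.
  - by apply: prodr_ge0 => j _; exact: ltW.
  - rewrite ler_expR.
    have -> : (- (T' * tau) = \sum_(z <- T) - tau)%R.
      by rewrite big_const_seq count_predT iter_addr_0 -mulrN mulr_natl.
    rewrite big_seq [leRHS]big_seq; apply: ler_sum => z zT.
    by have := Gl _ (sG z zT); rewrite ler_norml => /andP[].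
  - rewrite expR_sum; apply: ler_prod => j _; rewrite ltW //=.
    by have [_] := Af _ _ (sA j); rewrite lee_fin.
(* [E' f] differs from [E f] only by configurations outside of [D]. *)
have FPhi f : F [set x | (c f)%:E <= Phi x].
  rewrite -(measTypeE (evlcm_sigma_algebra hX)) -[X in measurable X]setTI.
  exact: emeasurable_fun_c_infty.
have FE' f : sigma_loc F (Lambda N) (E' f).
  apply: sigma_locI => //; exact: (sigma_loc_mean _ (FPhi f)).
have muE' f : mu (Lambda N) (E' f) = mu (Lambda N) (E f).
  apply: hmuD => //; apply/seteqP; split => s /= [h Ds]; split => //; first by case: h.
  by split => //; exact: key.
have tE' : trivIset setT E'.
  move=> f g _ _ [s [[[sf _] _] [[sg _] _]]]; apply/ffunP => j.
  by apply: tA => //; exists (mean (B j) s).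
pose bm : locType F (Lambda N) -> measType F := @box_mean R X F d (Lambda N).
have mbm : measurable_fun setT bm by exact: measurable_box_mean.
have mPhim : measurable_fun setT (Phi \o bm) by exact: measurableT_comp.
have := disjoint_sum_le_integral (mu (Lambda N)) FE' tE' mPhim (fun s => Phi0 _) c0 (fun f s => @proj2 _ _).
rewrite -(ge0_integral_distribution _ mPhi Phi0) -integral_mkcond.
apply: le_trans.
pose kap := expR (- (dl * nd)).
apply: (@le_trans _ _ (\sum_(f : {ffun J -> I})
    (c f * (al ^+ #|` T|%fset * \prod_j (kap * q (f j))))%:E)); last first.
  apply: lee_sum => f _; rewrite EFinM lee_wpmul2l ?lee_fin //.
  rewrite -[leRHS]/(mu (Lambda N) (E' f)) muE'.
  apply: (packed_ge hB (fun j => FA (f j)) (fun j => q0 (f j)) _ hG (ltW al0)) => j.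
  by rewrite qE.
rewrite sumEFin lee_fin.
(* Expansion of the product over the blocks of the sums over the levels. *)
have -> : (\sum_(f : {ffun J -> I}) c f * (al ^+ #|` T|%fset * \prod_j (kap * q (f j))) =
    expR (- (T' * tau)) * (al ^+ #|` T|%fset * (kap * \sum_i v i * q i) ^+ #|J|))%R.
  rewrite -prodr_const mulr_sumr bigA_distr_bigA /= mulrA mulr_sumr.
  apply: eq_bigr => f _; rewrite /c mulrACA; congr (_ * _)%R.
  rewrite -big_split /=; apply: eq_bigr => j _; ring.
apply: (@le_trans _ _ (expR (- (T' * tau)) * (al ^+ #|` T|%fset *
    (kap * expR (nd * a)) ^+ #|J|)))%R.
  rewrite -{1}(lnK (_ : al \is Num.pos)) // -/la -expRM_natl -expRD -expRM_natl -!expRD ler_expR.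
  apply: laplace_arith (ltW dl0) tau0 _ _ dlE => //.
  - by rewrite /nd /T' /Nd -(packed_card hB) natrD natrM.
  - exact: (packed_small hB).
rewrite ler_wpM2l ?expR_ge0 // ler_wpM2l ?exprn_ge0 ?(ltW al0) //.
apply: lerXn2r; rewrite ?nnegrE ?mulr_ge0 ?expR_ge0 //.
  by apply: sumr_ge0 => i _; rewrite mulr_ge0 // ltW.
by rewrite ler_wpM2l ?expR_ge0.
Qed.

End LaplaceLower.

(** * Pressure *)

Section LimitComparison.
Context {R : realType}.
Implicit Types u v : nat -> \bar R.

Lemma limn_esup_mono u v : (forall n, u n <= v n) -> limn_esup u <= limn_esup v.
Proof.
move=> uv; apply: gee_real => a /limn_esup_lt[m h]; apply: (@limn_esup_le _ _ _ m) => n mn.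
exact: (le_trans (uv n) (ltW (h n mn))).
Qed.

Lemma limn_einf_mono u v : (forall n, u n <= v n) -> limn_einf u <= limn_einf v.
Proof.
move=> uv; apply: lee_real => a /lt_limn_einf[m h]; apply: (@le_limn_einf _ _ _ m) => n mn.
exact: (le_trans (ltW (h n mn)) (uv n)).
Qed.

Lemma cvg_limn_esup u : limn_esup u <= limn_einf u -> u @ \oo --> limn_esup u.
Proof.
move=> h; have e : limn_einf u = limn_esup u.
  by apply/eqP; rewrite eq_le limn_einf_sup h.
apply: (@squeeze_cvge _ _ _ _ (einfs u) _ (esups u)).
- apply: nearW => n; apply/andP; split.
    by apply: ereal_inf_lbound; exists n => /=.
  by apply: ereal_sup_ubound; exists n => /=.
- by rewrite -e limn_einf_lim; exact: is_cvg_einfs.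
- by rewrite limn_esup_lim; exact: is_cvg_esups.
Qed.

End LimitComparison.

Section Pressure.
Context {R : realType} {X : tvsType R} {F C0 : set (set X)} {d : nat}.
Local Notation Zd := 'rV[int]_d.
Local Notation config := (Zd -> X).
Hypothesis hX : evlcm F C0.
Hypothesis hd : (0 < d)%N.
Variable mu : forall L : box d, probability (locType F L) R.
Hypothesis hmu : scit mu.
Hypothesis hadi : adi mu.
Hypothesis hcl : locally_controlled mu.
Variable D : set X.
Hypothesis hD : convex_set D.
Hypothesis hmuD : carried mu [set s : config | forall z, D (s z)].
Implicit Types (G A : set X) (l : {scalar X}) (x y : X).

(** All the values in [G], so that their mean is in [A]. *)
Lemma all_sites_ge G A (a : R) n : site_ge mu G a -> (0 <= a)%R -> (0 < n)%N -> F A ->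
  (forall s : config, (forall z, z \in (Lambda n : {fset Zd}) -> G (s z)) ->
    (forall z, D (s z)) -> A (mean (Lambda n) s)) ->
  (a ^+ (n ^ d))%:E <= cramer mu n A.
Proof.
move=> hG a0 n0 FA h; have FG := hG.1.
have := @sites_ge _ _ _ _ mu hmu G a (Lambda n) fset0 setT (Lambda n : {fset Zd}) hG a0
  (fset_uniq _) (fun=> id) (fun _ _ => isT) (fsub0set _) (@sigma_locT _ _ _ _ _).
rewrite -[size _]/(#|` (Lambda n : {fset Zd})|%fset) card_Lambda // setIT.
rewrite probability_setT mule1 => /le_trans; apply.
set E := [set s | _].
have FE : sigma_loc F (Lambda n) E by exact: sigma_loc_sites.
have FmA : sigma_loc F (Lambda n) [set s : config | A (mean (Lambda n) s)].
  exact: (sigma_loc_mean (fsubset_refl _) FA).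
have -> : mu (Lambda n) E = mu (Lambda n) (E `&` [set s : config | A (mean (Lambda n) s)]).
  apply: hmuD => //; first exact: sigma_locI.
  apply/seteqP; split => s /= => [[Es Ds]|[[Es _] Ds]] //.
  by do 2!split => //; exact: h.
rewrite cramerE; apply: le_measure; rewrite ?inE; [exact: sigma_locI|exact: FmA|].
by move=> s [].
Qed.

Let mF A : F A -> measurable (A : set (measType F)) := @measurable_measType _ _ _ A.

Let mexp l (c : R) : dual_space X l ->
  measurable_fun setT (fun x : measType F => (expR (c * l x))%:E).
Proof. by move=> ld; apply: measurable_laplace; exact: (evlcm_measurable_form hX). Qed.

Lemma chebyshev l A (c : R) n : dual_space X l -> F A -> (0 < n)%N ->
  (forall x, A x -> c <= l x)%R ->
  (expR ((n ^ d)%:R * c))%:E * cramer mu n A <= laplace mu setT l n.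
Proof.
move=> ld FA n0 cA; rewrite /laplace card_Lambda //.
apply: (@le_trans _ _ (\int[cramer mu n]_(x in A) (expR ((n ^ d)%:R * l (x : X)))%:E)).
  apply: cst_le_integral => //; first exact: mF.
  - exact: mexp.
  - by move=> x Ax; rewrite lee_fin ler_expR ler_wpM2l // cA.
apply: ge0_subset_integral => //; first exact: mF.
exact: mexp.
Qed.

(** Confining all the sites to a ball costs a constant per site. Since the
   pressure is not [-oo], its difference with an entropy equal to [-oo] is
   [+oo]. *)
Lemma pressure_gtNy l : dual_space X l -> -oo < pressure mu l.
Proof.
move=> ld; have [p ap lp] := dual_adapted hX ld; have [hp _] := ap.
have [t [a [t0 a0 hG]]] := adapted_site hX hmu hcl ap.
set G := [set x | _] in hG.
have cG : convex_set G.
  apply/convexP => x y u /andP[u0 u1] px py; rewrite /G /=.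
  have [_ pD pZ] := hp; apply: (le_lt_trans (pD _ _)); rewrite !pZ !ger0_norm ?subr_ge0 //.
  move: px py; rewrite /G /= => px py.
  have [->|un] := eqVneq u 0%R; first by rewrite mul0r add0r subr0 mul1r.
  have up : (0 < u)%R by rewrite lt_neqAle eq_sym un.
  have : (u * p x < u * t)%R by rewrite ltr_pM2l.
  have : ((1 - u) * p y <= (1 - u) * t)%R by rewrite ler_wpM2l ?subr_ge0 // ltW.
  lra.
apply: (@lt_le_trans _ _ (ln a - t)%:E); first by rewrite ltNyr.
apply: le_trans (limn_einf_sup _); apply: (@le_limn_einf _ _ _ 1) => n n0.
rewrite -[X in _ <= rate d n X]/(laplace mu setT l n).
rewrite le_rate ?laplace_ge0 // card_Lambda //.
have lG x : G x -> (- t <= l x)%R.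
  by rewrite /G /= => pxt; have := lp x; rewrite ler_norml => /andP[]; lra.
apply: le_trans (chebyshev ld hG.1 n0 lG).
have : (a ^+ (n ^ d))%:E <= cramer mu n G.
  by apply: (all_sites_ge hG (ltW a0) n0 hG.1) => s Gs _; exact: mean_convex.
rewrite -{1}(lnK (_ : a \is Num.pos)) // -expRM_natl => h.
rewrite mulrBr addrC expRD -mulrN EFinM lee_wpmul2l ?lee_fin ?expR_ge0 //.
Qed.

Lemma entropy_le_pressure l x : dual_space X l ->
  (l x)%:E <= pressure mu l - entropy C0 mu x.
Proof.
move=> ld; have pN := pressure_gtNy ld.
have [sE|sN] := eqVneq (entropy C0 mu x) -oo.
  by rewrite sE /= addey ?leey // gt_eqF.
have sfin : entropy C0 mu x \is a fin_num.
  rewrite fin_numE sN /= lt_eqF //.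
  exact: le_lt_trans (entropy_le0 hX mu x) (ltry _).
rewrite -(fineK sfin) leeBrDr //; set sx := fine _.
rewrite -EFinD; apply: lee_epsilon => e e0.
have e2 : (0 < e / 2)%R by rewrite divr_gt0.
have [p ap lp] := dual_adapted hX ld.
have := entropy_le hX mu x ap e2; rewrite -(fineK sfin) -/sx => h.
have : (sx - e / 2)%:E < limn_einf (fun n => rate d n (cramer mu n (sball p x (e / 2)))).
  by apply: lt_le_trans h; rewrite lte_fin; lra.
move=> /lt_limn_einf[m hm]; apply: le_trans (limn_einf_sup _).
apply: (@le_limn_einf _ _ _ m.+1) => n mn; have n0 : (0 < n)%N by exact: leq_trans mn.
rewrite -[X in _ <= rate d n X]/(laplace mu setT l n).
rewrite le_rate ?laplace_ge0 // card_Lambda //.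
have FB : F (sball p x (e / 2)) by exact: (measurable_sball hX).
have lB y : sball p x (e / 2) y -> (l x - e / 2 <= l y)%R.
  rewrite /sball /= => pe; have := lp (y - x)%R; rewrite linearB /= ler_norml => /andP[]; lra.
apply: le_trans (chebyshev ld FB n0 lB).
have := hm n (ltnW mn); rewrite lt_rate // card_Lambda // => /ltW h'.
apply: le_trans (lee_wpmul2l _ h'); last by rewrite lee_fin expR_ge0.
by rewrite -EFinM -expRD lee_fin ler_expR -mulrDr ler_wpM2l //; lra.
Qed.

(** The lower bound for Laplace transforms over the whole space, where the upper
   limit along the small cubes is at most the lower limit along the large ones. *)
Lemma log_laplace_cvg l : dual_space X l -> log_laplace mu l @ \oo --> pressure mu l.
Proof.
move=> ld; apply: cvg_limn_esup; apply: lee_real => a alt; apply: lee_epsilon => e e0.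
have [p ap lp] := dual_adapted hX ld.
have [t [al [t0 al0 hG]]] := adapted_site hX hmu hcl ap.
have [n0 hn0] := laplace_lower_bound hX hd hmu hadi hD hmuD a ld (ltW t0) al0 e0.
have [n nn0 an] := lt_limn_esup n0 alt.
have [_ h] := hn0 n nn0.
have hF := evlcm_sigma_algebra hX.
have [] := h setT _ _ _ hG (@subsetT _ _) _ an.
- by rewrite -(measTypeE hF); exact: measurableT.
- by rewrite setTI.
- by move=> z pz; apply: (le_trans (lp z)); exact: ltW.
by move=> N0 hN; exact: le_limn_einf hN.
Qed.

Lemma site_geW G (a b : R) : (b <= a)%R -> site_ge mu G a -> site_ge mu G b.
Proof.
move=> ba [FG h]; split => // L B L0 FB; apply: le_trans (h L B L0 FB).
by rewrite lee_wpmul2r.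
Qed.

(** Local convex tightness restricts the Laplace transforms to convex sets with
   relatively compact trace, at an arbitrarily small cost, where the upper bound
   applies. *)
Lemma pressure_le_sup l : convex_tight mu D -> dual_space X l ->
  pressure mu l <= ereal_sup [set (l x)%:E + entropy C0 mu x | x in setT].
Proof.
move=> hctl ld; apply: lee_real => a alt; apply: lee_epsilon => e e0.
have [p ap lp] := dual_adapted hX ld.
have [t [al [t0 al0 hG]]] := adapted_site hX hmu hcl ap.
have al2 : (0 < al / 2)%R by rewrite divr_gt0.
have [n0 hn0] := laplace_lower_bound hX hd hmu hadi hD hmuD a ld (ltW t0) al2 e0.
have [n nn0 an] := lt_limn_esup n0 alt.
have [np h] := hn0 n nn0.
move: an; rewrite -[X in _ < rate d n X]/(laplace mu setT l n).
rewrite lt_rate ?laplace_ge0 // card_Lambda // {1}/laplace card_Lambda // => an.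
have [eta eta0 heta] := integral_tight (mexp _ ld) (fun _ => expR_ge0 _) an.
(* The first bound on [ga] keeps half of the local control when the sites are
   also required to be in [K]; the second one makes [K] almost certain for the
   mean over the cube of side [n], which is already fixed. *)
pose ga : R := (Num.min (al / 2) (Num.min (eta / (n ^ d)%:R) 1))%R.
have nd0 : (0 < (n ^ d)%:R :> R)%R by rewrite ltr0n expn_gt0 np.
have ga0 : (0 < ga)%R by rewrite !lt_min al2 divr_gt0 //= ltr01.
have ga1 : (ga <= al / 2)%R by rewrite ge_min lexx.
have ga2 : (ga * (n ^ d)%:R <= eta)%R.
  by rewrite -ler_pdivlMr // !ge_min lexx orbT.
have ga3 : (ga <= 1)%R by rewrite !ge_min lexx !orbT.
have [K [FK cK rK hK]] := hctl ga ga0.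
have hsK : site_ge mu K (1 - ga).
  by apply: cond_prob_ge_site => // L L0; exact: (hK L L L0 (fsubset_refl _)).
have muK : (1 - eta)%:E <= cramer mu n K.
  have : ((1 - ga) ^+ (n ^ d))%:E <= cramer mu n K.
    apply: (all_sites_ge hsK _ np FK); first by rewrite subr_ge0.
    move=> s Ks Ds; apply: (proj1 (mean_convex cK _)) => z zL; split => //.
    exact: Ks.
  apply: le_trans; rewrite lee_fin; apply: le_trans (bernoulli _ _); last by rewrite ltW.
  by rewrite lerD2l lerN2 mulrC.
have hF := evlcm_sigma_algebra hX.
have := heta K (mF FK) muK => aK.
have hGK : site_ge mu ([set x | (p x < t)%R] `&` K) (al / 2).
  apply: site_geW (site_geI hF hG hsK); lra.
have [] := h K _ FK cK hGK (@subIsetr _ _ _).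
- by move=> z [pz _]; apply: (le_trans (lp z)); exact: ltW.
- by rewrite lt_rate ?laplace_ge0 // card_Lambda // /laplace card_Lambda.
move=> N0 hN.
have ub := laplace_upper_bound hX hd hmu hadi hcl hD hmuD FK rK
  (evlcm_measurable_form hX ld).
have {}ub := ub (ex_intro2 _ _ p ap (fun x y => eq_ind _ (fun v => `|v| <= p (x - y))%R (lp (x - y)%R) _ (linearB l x y))).
apply: (@le_trans _ _ (limn_esup (fun n => rate d n (laplace mu K l n)))).
  by apply: le_trans (limn_einf_sup _); exact: le_limn_einf hN.
apply: (le_trans ub); apply: le_ereal_sup => _ [x _ <-].
by exists x.
Qed.

End Pressure.

(** * Duality and traces *)

Section Duality.
Context {R : realType} {X : tvsType R} {F C0 : set (set X)} {d : nat}.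
Hypothesis hX : evlcm F C0.
Hypothesis hd : (0 < d)%N.
Variable mu : forall L : box d, probability (locType F L) R.
Hypothesis hmu : scit mu.
Hypothesis hadi : adi mu.
Hypothesis hcl : locally_controlled mu.
Implicit Types (x y z w : X) (p : X -> R).

Let s := entropy C0 mu.

Let entropy_concave_le x y (t a b : R) : (0 <= t <= 1)%R -> a%:E <= s x -> b%:E <= s y ->
  (t * a + (1 - t) * b)%:E <= s (t *: x + (1 - t) *: y)%R.
Proof.
move=> t01 ax by_; apply: lee_epsilon => e e0.
rewrite (_ : (_ - e = t * (a - e) + (1 - t) * (b - e))%R); last by ring.
apply: (entropy_concave hX hd hmu hadi hcl t01).
  by apply: lt_le_trans ax; rewrite lte_fin; lra.
by apply: lt_le_trans by_; rewrite lte_fin; lra.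
Qed.

Let entropy_near x (a : R) : s x < a%:E ->
  exists2 p, adapted C0 p & forall z, (p z < 1)%R -> s (x + z)%R < a%:E.
Proof.
move=> /(entropy_lt hX)[p ap lta]; exists p => // z pz.
apply: le_lt_trans lta; have [[p0 pD _] _] := ap.
have r0 : (0 < 1 - p z)%R by rewrite subr_gt0.
apply: (le_trans (entropy_le hX mu (x + z)%R ap r0)).
apply: limn_einf_mono => n; apply: rate_mono => //; apply: le_measure.
- by rewrite inE; apply: measurable_measType; exact: (measurable_sball hX).
- by rewrite inE; apply: measurable_measType; exact: (measurable_sball hX).
move=> y; rewrite /sball /= => h.
rewrite (_ : (y - x = (y - (x + z)) + z)%R); last by rewrite opprD addrA subrK.
apply: (le_lt_trans (pD _ _)); lra.
Qed.

(** Fenchel-Moreau duality for the entropy. The cone is the sum of the cone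
   generated by the epigraph of [z |-> a - s (x + z)] and of the epigraph of
   [M p]: a linear form below both is continuous and separates [(x, a)] from the
   hypograph of [s]. It has no point [(0, v)] with [v < 0] because [s < a] on
   the unit ball of [p] around [x], and [s <= 0 <= a + M] outside of it. *)
Lemma entropy_separation x (a : R) : s x < a%:E ->
  exists2 l : {scalar X}, dual_space X l & forall y, (l y)%:E + s y <= (l x + a)%:E.
Proof.
move=> sxa; have [p ap near_] := entropy_near sxa.
have [[p0 pD pZ] _] := ap; have hp := ap.1.
pose M := `|a|%R.
pose P : set (X * R)%type := [set q | exists (r : R) z (u : R) w,
  [/\ (0 <= r)%R, (0 < r)%R -> u%:E <= s (x + z)%R, q.1 = (r *: z + w)%R &
      (r * (a - u) + M * p w <= q.2)%R]].
have M0 : (0 <= M)%R by exact: normr_ge0.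
have Pcone : epi_cone P.
  split.
  - exists 0%R, 0%R, 0%R, 0%R; split => //=; first by rewrite ltxx.
      by rewrite scaler0 addr0.
    by rewrite mul0r add0r (seminorm0 hp) mulr0.
  - move=> y1 y2 v1 v2 [r1 [z1 [u1 [w1 [/= r10 h1 -> v1E]]]]]
      [r2 [z2 [u2 [w2 [/= r20 h2 -> v2E]]]]].
    have pw : (M * p (w1 + w2) <= M * p w1 + M * p w2)%R.
      by rewrite -mulrDr ler_wpM2l.
    have [r1E|r1n] := eqVneq r1 0%R.
      exists r2, z2, u2, (w1 + w2)%R; split => //=.
        by rewrite r1E scale0r add0r addrCA.
      by rewrite r1E mul0r add0r in v1E; lra.
    have [r2E|r2n] := eqVneq r2 0%R.
      exists r1, z1, u1, (w1 + w2)%R; split => //=.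
        by rewrite r2E scale0r add0r addrA.
      by rewrite r2E mul0r add0r in v2E; lra.
    have r1p : (0 < r1)%R by rewrite lt_neqAle eq_sym r1n.
    have r2p : (0 < r2)%R by rewrite lt_neqAle eq_sym r2n.
    have rp := addr_gt0 r1p r2p; have rn : (r1 + r2 != 0)%R by rewrite gt_eqF.
    pose t := (r1 / (r1 + r2))%R.
    have tE : (1 - t = r2 / (r1 + r2))%R by rewrite /t; field.
    have t01 : (0 <= t <= 1)%R.
      by rewrite divr_ge0 ?(ltW rp) //= ler_pdivrMr // mul1r lerDl.
    exists (r1 + r2)%R, (t *: z1 + (1 - t) *: z2)%R, (t * u1 + (1 - t) * u2)%R, (w1 + w2)%R.
    split => /=.
    + exact: ltW.
    + move=> _.
      rewrite (_ : (x + _ = t *: (x + z1) + (1 - t) *: (x + z2))%R); last first.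
        by rewrite !scalerDr addrACA -scalerDl [(t + _)%R]addrC subrK scale1r.
      by apply: entropy_concave_le => //; [exact: h1|exact: h2].
    + rewrite scalerDr !scalerA tE /t mulrCA divff // mulr1.
      by rewrite mulrCA divff // mulr1 addrACA.
    + have -> : ((r1 + r2) * (a - (t * u1 + (1 - t) * u2)) = r1 * (a - u1) + r2 * (a - u2))%R.
        by rewrite tE /t; field.
      lra.
  - move=> r y v r0 [r1 [z [u [w [/= r10 h -> vE]]]]].
    exists (r * r1)%R, z, u, (r *: w)%R; split => /=.
    + by rewrite mulr_ge0 // ltW.
    + by rewrite pmulr_rgt0.
    + by rewrite scalerDr scalerA.
    + rewrite pZ gtr0_norm // (_ : (_ + _ = r * (r1 * (a - u) + M * p w))%R); last by ring.
      by rewrite ler_wpM2l // ltW.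
  - move=> v [r [z [u [w [/= r0 h /esym/eqP + vE]]]]].
    rewrite addrC addr_eq0 => /eqP wE; apply: le_trans vE.
    have pw : p w = (r * p z)%R by rewrite wE (seminormN _ hp) pZ ger0_norm.
    rewrite pw mulrCA -mulrDr.
    move: r0; rewrite le_eqVlt => /orP[/eqP <-|r0]; first by rewrite mul0r.
    have {}h := h r0; apply: mulr_ge0; first exact: ltW.
    have [pz|pz] := ltP (p z) 1%R.
      have : u%:E < a%:E by apply: le_lt_trans h _; exact: near_.
      by rewrite lte_fin => ua; rewrite addr_ge0 ?mulr_ge0 // subr_ge0 ltW.
    have u0 : (u <= 0)%R.
      by rewrite -lee_fin; apply: (le_trans h); exact: (entropy_le0 hX).
    have : (M <= M * p z)%R by rewrite ler_peMr.
    have : (- M <= a)%R by rewrite /M lerNl -normrN ler_norm.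
    lra.
have [|l hl] := epi_cone_form Pcone.
  move=> y; exists (M * p y)%R; exists 0%R, 0%R, 0%R, y; split => //=; first by rewrite ltxx.
    by rewrite scale0r add0r.
  by rewrite mul0r add0r.
(* [l] is below [M p] because the cone contains the epigraph of [M p]. *)
exists l.
  apply: (adapted_dual hX ap (M := M)) => y; apply: hl.
  exists 0%R, 0%R, 0%R, y; split => //=; first by rewrite ltxx.
    by rewrite scale0r add0r.
  by rewrite mul0r add0r.
move=> y; have [->|sN] := eqVneq (s y) -oo; first by rewrite addeNy leNye.
have sfin : s y \is a fin_num.
  rewrite fin_numE sN /= lt_eqF //.
  exact: le_lt_trans (entropy_le0 hX mu y) (ltry _).
rewrite -(fineK sfin) -EFinD lee_fin.
have : (l (y - x) <= a - fine (s y))%R.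
  apply: hl; exists 1%R, (y - x)%R, (fine (s y)), 0%R; split => //=.
  - by move=> _; rewrite fineK // addrC subrK.
  - by rewrite scale1r addr0.
  - by rewrite mul1r (seminorm0 hp) mulr0 addr0.
by rewrite linearB /=; lra.
Qed.

End Duality.

Section Trace.
Context {R : realType} {X : tvsType R} {F C0 : set (set X)} {d : nat}.
Hypothesis hX : evlcm F C0.
Implicit Types (x y : X).

Lemma evlcm_hausdorff : hausdorff_space X.
Proof.
move=> x y xy; apply: contrapT => nxy.
have [C CC Cxy] : exists2 C, C0 C & ~ C (x - y)%R.
  apply: contrapT => h; apply: nxy; apply/eqP; rewrite -subr_eq0; apply/eqP.
  have : (\bigcap_(C in C0) C) (x - y)%R.
    by move=> C CC; apply: contrapT => nC; apply: h; exists C.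
  by rewrite (evlcm_bigcap hX).
have [p ap CE] := C0_adapted hX CC; have [hp _] := ap; have [_ pD _] := hp.
have r0 : (0 < 2^-1 :> R)%R by rewrite invr_gt0.
have [z [zx zy]] := xy _ _ (nbhs_sball hX x ap r0) (nbhs_sball hX y ap r0).
apply: Cxy; rewrite CE /=; move: zx zy; rewrite /sball /= => zx zy.
rewrite (_ : (x - y = - (z - x) + (z - y))%R); last by rewrite opprB addrA subrK.
apply: (le_lt_trans (pD _ _)); rewrite (seminormN _ hp); lra.
Qed.

Lemma rel_compactW (A B : set X) : A `<=` B -> rel_compact B -> rel_compact A.
Proof.
move=> AB cB; apply: subclosed_compact cB _; first exact: closed_closure.
exact: closure_subset.
Qed.

Variable mu : forall L : box d, probability (locType F L) R.
Variable D : set X.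
Hypothesis hD : convex_set D.
Hypothesis hmuD : carried mu [set s : 'rV[int]_d -> X | forall z, D (s z)].

(** Compactness in [D] is compactness in [X], where compact sets are closed. *)
Lemma closure_trace (K : set X) : rel_compact (set_val @^-1` K : set D) ->
  closure (K `&` D) `<=` set_val @` closure (set_val @^-1` K : set D) /\
  rel_compact (K `&` D).
Proof.
move=> cK; set K' := (_ @^-1` _ : set D) in cK *.
have cim : compact (set_val @` closure K' : set X).
  apply: continuous_compact cK; apply: continuous_subspaceT.
  exact: initial_continuous.
have cl : closed (set_val @` closure K' : set X).
  by apply: compact_closed cim; exact: evlcm_hausdorff.
have sub : closure (K `&` D) `<=` set_val @` closure K'.
  rewrite [X in _ `<=` X](closure_id _).1 //; apply: closure_subset.
  move=> x [Kx Dx]; exists (SigSub (mem_set Dx)) => //.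
  by apply: subset_closure.
by split => //; apply: subclosed_compact cim sub; exact: closed_closure.
Qed.

Lemma entropy_trace_ge (x : D) : entropy C0 mu (set_val x) <= entropy_trace C0 mu D x.
Proof.
apply: le_ereal_inf_tmp => _ [_ [C [C' CC' CE] <-] <-].
apply: (@le_trans _ _ (limn_einf (fun n => rate d n (cramer mu n C)))).
  by apply: ereal_inf_lbound; exists C => //; exists C'.
have FC : F C.
  rewrite -CE; apply: (evlcm_translate_sets hX).
  by have [] := evlcm_internal hX CC'.
apply: limn_einf_mono => n; apply: rate_mono => //.
apply: le_ereal_inf_tmp => _ [A [FA AE] <-].
rewrite (cramer_carried hD hmuD n FC FA) //.
apply/seteqP; split => z [h Dz]; split => //.
  have : (set_val @^-1` C) (SigSub (mem_set Dz) : D) by [].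
  by rewrite -AE.
have : (set_val @^-1` A) (SigSub (mem_set Dz) : D) by [].
by rewrite AE.
Qed.

Lemma cramer_trace_ge0 n B : 0 <= cramer_trace mu D n B.
Proof. by apply: le_ereal_inf_tmp => _ [A _ <-]. Qed.

End Trace.

(** * The theorem *)

Theorem mainTheorem1 (R : realType) (X : tvsType R) (F C0 : set (set X))
    (hX : evlcm F C0)
    (d : nat) (hd : (0 < d)%N)
    (D : set X) (hD : convex_set D)
    (mu : forall L : box d, probability (locType F L) R)
    (hmu : scit mu)
    (hmuD : carried mu [set s : 'rV[int]_d -> X | forall z, D (s z)])
    (hadi : adi mu) (hcl : locally_controlled mu) :
  [/\ [/\ forall K : set X, F K -> rel_compact (K `&` D) ->
            limn_esup (fun n => rate d n (cramer mu n K))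
              <= ereal_sup (entropy C0 mu @` closure K),
          weak_ldp d F (cramer mu) (entropy C0 mu) &
          weak_ldp d (trace_sets F D) (cramer_trace mu D) (entropy_trace C0 mu D)],
      (forall l, dual_space X l -> log_laplace mu l @ \oo --> pressure mu l) /\
      (forall l, dual_space X l -> forall x : X,
         (l x)%:E <= pressure mu l - entropy C0 mu x) &
      convex_tight mu D ->
        forall x : X, entropy C0 mu x =
          ereal_inf [set pressure mu l - (l x)%:E | l in dual_space X]].
Proof.
have [p0 ap0] : exists p, adapted C0 p.
  have : nbhs (0%R : X) setT by exact: filter_nbhsT.
  by rewrite (evlcm_nbhs hX) => -[C CC _]; have [p ap _] := C0_adapted hX CC; exists p.
have hF := evlcm_sigma_algebra hX.
have upper (K : set X) : F K -> rel_compact (K `&` D) ->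
    limn_esup (fun n => rate d n (cramer mu n K)) <=
    ereal_sup (entropy C0 mu @` closure (K `&` D)).
  move=> FK cK.
  have m0 : measurable_fun setT ((fun=> 0%R) : measType F -> R) by exact: measurable_cst.
  have l0 : exists2 p, adapted C0 p & forall x y : X, (`|0 - 0 : R| <= p (x - y))%R.
    by exists p0 => // x y; rewrite subrr normr0; have [[]] := ap0.
  (* For the zero form, the Laplace transform over [K] is the measure of [K]. *)
  have := laplace_upper_bound hX hd hmu hadi hcl hD hmuD FK cK m0 l0.
  have E n : laplace mu K (fun=> 0%R) n = cramer mu n K.
    rewrite /laplace; under eq_integral do rewrite mulr0 expR0.
    by rewrite integral_cst ?mul1e //; exact: measurable_measType.
  rewrite -[X in limn_esup X <= _]/(fun n => rate d n (laplace mu K (fun=> 0%R) n)).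
  under eq_fun do rewrite E.
  move=> /le_trans; apply; apply: le_ereal_sup => _ [x Kx <-].
  by exists x => //; rewrite add0e.
split; [split|split|].
- move=> K FK cK; apply: (le_trans (upper K FK cK)).
  by apply: le_ereal_sup; apply: image_subset; apply: closure_subset; exact: subIsetl.
- move=> K FK cK; apply: (le_trans (upper K FK _)).
    exact: rel_compactW (@subIsetl _ _ _) cK.
  by apply: le_ereal_sup; apply: image_subset; apply: closure_subset; exact: subIsetl.
- move=> _ [K FK <-]; rewrite setTI => cK.
  have [sub cKD] := closure_trace hX cK.
  apply: (@le_trans _ _ (limn_esup (fun n => rate d n (cramer mu n K)))).
    apply: limn_esup_mono => n; apply: rate_mono; first exact: cramer_trace_ge0.
    by apply: ereal_inf_lbound; exists K.
  apply: (le_trans (upper K FK cKD)); apply: ge_ereal_sup => _ [x /sub[y Ky <-] <-].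
  apply: (le_trans (entropy_trace_ge hX hD hmuD y)).
  by apply: ereal_sup_ubound; exists y.
- by move=> l ld; exact: (log_laplace_cvg hX hd hmu hadi hcl hD hmuD).
- by move=> l ld x; exact: (entropy_le_pressure hX hmu hcl hmuD).
move=> hct x; apply/eqP; rewrite eq_le; apply/andP; split.
  apply: le_ereal_inf_tmp => _ [l ld <-].
  have := entropy_le_pressure hX hmu hcl hmuD x ld.
  have pN := pressure_gtNy hX hmu hcl hmuD ld.
  have s0 := entropy_le0 hX mu x.
  move: pN s0; case: (pressure mu l) => [p| |] // _; case: (entropy C0 mu x) => [s| |] // _;
    rewrite ?leey ?leNye // -!EFinB !lee_fin; lra.
apply: gee_real => a sa.
have [l ld hl] := entropy_separation hX hd hmu hadi hcl sa.
apply: (@le_trans _ _ (pressure mu l - (l x)%:E)).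
  by apply: ereal_inf_lbound; exists l.
rewrite leeBlDr // -EFinD addrC.
apply: (le_trans (pressure_le_sup hX hd hmu hadi hcl hD hmuD hct ld)).
by apply: ge_ereal_sup => _ [y _ <-]; exact: hl.
Qed.
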